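(* Let $G$ be a finite simple graph with at least one edge. If $\mathcal{R}(I_c(G))$ is Koszul, then $c(G)=1$ and $G$ satisfies the following conditions. (i) Any even cycle $C$ of $G$ of length $\geq 6$ has either an even-chord or three odd-chords $e,e',e''$ such that $e$ and $e'$ cross in $C$. (ii) If $C_1$ and $C_2$ are minimal odd cycles of $G$ with exactly one common vertex, then there exists an edge $\{i,j\}\in E(G)$ with $\{i,j\}\notin E(C_1)\cup E(C_2)$, $i\in V(C_1)$ and $j\in V(C_2)$. (iii) If $C_1$ and $C_2$ are minimal odd cycles of $G$ with $V(C_1)\cap V(C_2)=\emptyset$, then there exist at least two bridges between $C_1$ and $C_2$.
   Context: Let $K$ be a field, let $G$ be a finite simple graph with vertex set $V(G)=[n]=\{1,\dots,n\}$ and edge set $E(G)=\{e_1,\dots,e_m\}$, and let $S=K[x_1,\dots,x_n]$. For each $i$, write $e_i=\{p,q\}$ and put $u_i=(x_1\cdots x_n)/(x_px_q)$. The complementary edge ideal of $G$ is $I_c(G)=(u_1,\dots,u_m)\subset S$, and its Rees algebra is $\mathcal{R}(I_c(G))=\bigoplus_{k\ge 0}I_c(G)^kt^k\subset S[t]$. It is regarded as a standard graded $K$-algebra with the elements $x_1,\dots,x_n,u_1t,\dots,u_mt$ in degree $1$; Koszulness (the residue field $K$ has a linear graded free resolution over the algebra) is with respect to this grading. The number $c(G)$ is the number of connected components of $G$ having at least two vertices. Cycles have no repeated vertices; an even (odd) cycle is a cycle of even (odd) length. A chord of a cycle $C$ of $G$ is an edge of $G$ joining two vertices of $C$ which is not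 an edge of $C$. A cycle is minimal if it has no chord. A chord $e$ of an even cycle $C$ splits $C$ into two cycles, each formed by $e$ and one of the two paths of $C$ between the endpoints of $e$; $e$ is called an even-chord if these two cycles are even and an odd-chord if they are odd. Two chords $e=\{i,j\}$ and $e'=\{i',j'\}$ of $C$ with $e\cap e'=\emptyset$ cross in $C$ if $i'$ and $j'$ lie on different ones of the two paths of $C$ between $i$ and $j$. If $C_1,C_2$ are cycles with no common vertex, a bridge between $C_1$ and $C_2$ is an edge $\{i,j\}$ of $G$ with $i\in V(C_1)$ and $j\in V(C_2)$. *)

(* Defs.v *)
From HB Require Import structures.
From mathcomp Require Import all_boot all_order all_algebra.
From mathcomp Require Import boolp mpoly.

Set Implicit Arguments.
Unset Strict Implicit.
Unset Printing Implicit Defensive.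

Import GRing.Theory.
Local Open Scope ring_scope.

Section Koszul.
Variables (K : fieldType) (A : comAlgType K) (I : finType) (g : I -> A).

(* A is meant to be a standard graded K-algebra, the generators g i having
   degree 1; its component of degree d is then the K-span of the d-fold
   products of the g i. *)
Definition graded_part (d : nat) (a : A) : Prop :=
  exists c : {ffun 'I_d -> I} -> K,
    a = \sum_f c f *: \prod_(k < d) g (f k).

(* The ideal A_+ generated by the g i, so that the residue field K is A / A_+. *)
Definition irrelevant_ideal (a : A) : Prop :=
  exists c : I -> A, a = \sum_i c i * g i.

(* The complex
     ... --> A(-2)^(b 2) --d 1--> A(-1)^(b 1) --d 0--> A^(b 0) = A --> K --> 0,
   where the matrices act on row vectors from the right.  The shifts make the
   degree-preserving maps A(-i-1)^(b i.+1) -> A(-i)^(b i) exactly the matrices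
   with entries in the component of degree 1. *)
Definition linear_resolution (b : nat -> nat)
    (d : forall i, 'M[A]_(b i.+1, b i)) : Prop :=
  [/\ b 0%N = 1%N,
      forall i j k, graded_part 1 (d i j k),
      forall v : 'rV[A]_(b 0%N),
        (forall j, irrelevant_ideal (v 0 j)) <-> exists w, v = w *m d 0%N
    & forall i (v : 'rV[A]_(b i.+1)),
        v *m d i = 0 <-> exists w, v = w *m d i.+1].

Definition Koszul : Prop :=
  exists (b : nat -> nat) (d : forall i, 'M[A]_(b i.+1, b i)),
    linear_resolution d.

End Koszul.

Section IdealPower.
Variable S : comNzRingType.

Definition ideal_gen (I : finType) (u : I -> S) (a : S) : Prop :=
  exists c : I -> S, a = \sum_i c i * u i.

(* The coefficients c i only matter for k = 0, where J^0 = S. *)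
Definition ideal_exp (J : S -> Prop) (k : nat) (a : S) : Prop :=
  exists (m : nat) (c : 'I_m -> S) (f : 'I_m -> 'I_k -> S),
    (forall i j, J (f i j)) /\ a = \sum_i c i * \prod_j f i j.

Lemma ideal_exp0 J k : ideal_exp J k 0.
Proof.
exists 0%N, (fun _ => 0), (fun _ _ => 0).
by split=> [[]//|]; rewrite big_ord0.
Qed.

Lemma ideal_expD J k a b :
  ideal_exp J k a -> ideal_exp J k b -> ideal_exp J k (a + b).
Proof.
move=> [m [c [f [Jf ->]]]] [m' [c' [f' [Jf' ->]]]].
exists (m + m')%N,
  (fun i => match split i with inl i => c i | inr i => c' i end),
  (fun i => match split i with inl i => f i | inr i => f' i end).
split=> [i j|]; first by case: (split i).
rewrite big_split_ord; congr (_ + _); apply: eq_bigr => i _.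
  by case: (split_ordP (lshift m' i)) => i' => [/lshift_inj ->|/eqP];
    rewrite ?eq_lrshift.
by case: (split_ordP (rshift m i)) => i' => [/eqP|/rshift_inj ->];
  rewrite ?eq_rlshift.
Qed.

Lemma ideal_exp_sum J k (I : finType) (F : I -> S) :
  (forall i, ideal_exp J k (F i)) -> ideal_exp J k (\sum_i F i).
Proof.
move=> JF; elim/big_ind: _ => //; first exact: ideal_exp0.
by move=> x y; exact: ideal_expD.
Qed.

Lemma ideal_exp_mulr J k x a : ideal_exp J k a -> ideal_exp J k (x * a).
Proof.
move=> [m [c [f [Jf ->]]]]; exists m, (fun i => x * c i), f; split=> //.
by rewrite mulr_sumr; apply: eq_bigr => i _; rewrite mulrA.
Qed.

Lemma ideal_expM J k l a b :
  ideal_exp J k a -> ideal_exp J l b -> ideal_exp J (k + l) (a * b).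
Proof.
move=> [m [c [f [Jf ->]]]] [m' [c' [f' [Jf' ->]]]].
rewrite mulr_suml; apply: ideal_exp_sum => i.
rewrite mulr_sumr; apply: ideal_exp_sum => i'.
rewrite mulrACA; apply: ideal_exp_mulr.
exists 1%N, (fun _ => 1),
  (fun _ j => match split j with inl j => f i j | inr j => f' i' j end).
split=> [_ j|]; first by case: (split j).
rewrite big_ord1 mul1r big_split_ord; congr (_ * _); apply: eq_bigr => j _.
  by case: (split_ordP (lshift l j)) => j' => [/lshift_inj ->|/eqP];
    rewrite ?eq_lrshift.
by case: (split_ordP (rshift k j)) => j' => [/eqP|/rshift_inj ->];
  rewrite ?eq_rlshift.
Qed.

Lemma ideal_exp_full J a : ideal_exp J 0 a.
Proof.
exists 1%N, (fun _ => a), (fun _ _ => 0).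
by split=> [_ []//|]; rewrite big_ord1 big_ord0 mulr1.
Qed.

Lemma ideal_exp1 (J : S -> Prop) a : J a -> ideal_exp J 1 a.
Proof.
by move=> Ja; exists 1%N, (fun _ => 1), (fun _ _ => a);
  rewrite !big_ord1 mul1r.
Qed.

Lemma ideal_gen_mem (I : finType) (u : I -> S) i : ideal_gen u (u i).
Proof.
exists (fun j => (j == i)%:R); rewrite (bigD1 i) //= eqxx mul1r big1 ?addr0//.
by move=> j /negPf ->; rewrite mul0r.
Qed.

End IdealPower.

Record sgraph (n : nat) := SGraph {
  edges : {set {set 'I_n}};
  card_edge : forall e, e \in edges -> #|e| = 2%N
}.

Definition edge n (G : sgraph n) := {e : {set 'I_n} | e \in edges G}.

Section Rees.
Variables (K : fieldType) (n : nat) (G : sgraph n).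

(* The monomial (x_1 ... x_n) / (x_p x_q) for e = {p, q}. *)
Definition compl_monomial (e : edge G) : {mpoly K[n]} :=
  \prod_(i | i \notin val e) 'X_i.

Definition compl_edge_ideal : {mpoly K[n]} -> Prop := ideal_gen compl_monomial.

Definition in_rees : {pred {poly {mpoly K[n]}}} :=
  fun p => `[< forall k, ideal_exp compl_edge_ideal k p`_k >].

Lemma in_reesP (p : {poly {mpoly K[n]}}) :
  reflect (forall k, ideal_exp compl_edge_ideal k p`_k) (p \in in_rees).
Proof. exact: asboolP. Qed.

Fact in_rees_subring : subring_closed in_rees.
Proof.
split=> [|p q /in_reesP Rp /in_reesP Rq|p q /in_reesP Rp /in_reesP Rq];
  apply/in_reesP => k.
- rewrite coef1; case: k => [|k]; [exact: ideal_exp_full | exact: ideal_exp0].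
- rewrite coefB -mulN1r; apply: ideal_expD => //; exact: ideal_exp_mulr.
- rewrite coefM; apply: ideal_exp_sum => i.
  by rewrite -[X in ideal_exp _ X](@subnKC i) -1?ltnS //; exact: ideal_expM.
Qed.

HB.instance Definition _ :=
  GRing.isSubringClosed.Build {poly {mpoly K[n]}} in_rees in_rees_subring.

Record rees := Rees { rees_val :> {poly {mpoly K[n]}};
                      _ : rees_val \in in_rees }.

HB.instance Definition _ := [isSub for rees_val].
HB.instance Definition _ := [Choice of rees by <:].
HB.instance Definition _ := [SubChoice_isSubComNzRing of rees by <:].

Fact in_rees_const (s : {mpoly K[n]}) : s%:P \in in_rees.
Proof.
apply/in_reesP => k; rewrite coefC.
by case: k => [|k]; [exact: ideal_exp_full | exact: ideal_exp0].
Qed.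

Fact in_rees_gen (e : edge G) : (compl_monomial e)%:P * 'X \in in_rees.
Proof.
apply/in_reesP => k; rewrite coefMX coefC; case: k => [|[|k]] /=.
- exact: ideal_exp0.
- by apply: ideal_exp1; exact: ideal_gen_mem.
- exact: ideal_exp0.
Qed.

Definition rees_scalar (c : K) : rees := Rees (in_rees_const c%:MP).
Definition rees_scale (c : K) (p : rees) : rees := rees_scalar c * p.

Fact rees_scaleA a b p : rees_scale a (rees_scale b p) = rees_scale (a * b) p.
Proof.
by rewrite /rees_scale mulrA; congr (_ * _); apply: val_inj;
  rewrite /= mpolyCM polyCM.
Qed.

Fact rees_scale1 : left_id 1 rees_scale.
Proof. by move=> p; apply: val_inj; rewrite /= mpolyC1 polyC1 mul1r. Qed.

Fact rees_scaleDr : right_distributive rees_scale +%R.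
Proof. by move=> c p q; rewrite /rees_scale mulrDr. Qed.

Fact rees_scaleDl p : {morph rees_scale^~ p : a b / a + b}.
Proof.
move=> a b; rewrite /rees_scale -mulrDl; congr (_ * _); apply: val_inj.
by rewrite /= mpolyCD polyCD.
Qed.

HB.instance Definition _ := GRing.Zmodule_isLmodule.Build K rees
  rees_scaleA rees_scale1 rees_scaleDr rees_scaleDl.

Fact rees_scaleAl (c : K) (p q : rees) : c *: (p * q) = (c *: p) * q.
Proof. exact: mulrA. Qed.

HB.instance Definition _ := GRing.Lmodule_isLalgebra.Build K rees rees_scaleAl.
HB.instance Definition _ := GRing.Lalgebra_isComAlgebra.Build K rees.

Definition rees_gen (z : 'I_n + edge G) : rees :=
  match z with
  | inl i => Rees (in_rees_const 'X_i)
  | inr e => Rees (in_rees_gen e)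
  end.

End Rees.

Section Cycles.
Variables (n : nat) (G : sgraph n).
Implicit Types (c : seq 'I_n) (e : {set 'I_n}).

Definition adj : rel 'I_n := fun i j => [set i; j] \in edges G.

Definition components : {set {set 'I_n}} :=
  equivalence_partition (connect adj) [set: 'I_n].

Definition num_components : nat := #|[set B in components | (1 < #|B|)%N]|.

(* c lists the vertices of the cycle in cyclic order. *)
Definition is_cycle c : bool := (2 < size c)%N && ucycleb adj c.

Definition cycle_edges c : {set {set 'I_n}} :=
  [set [set x; next c x] | x in [set x in c]].

Definition chord c e : bool :=
  [&& e \in edges G, e \subset [set x in c] & e \notin cycle_edges c].

Definition minimal_cycle c : Prop := is_cycle c /\ forall e, ~~ chord c e.

(* The path of c from i to j, both ends included.  When {i, j} is a chord this
   list also represents the cycle which the chord closes. *)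
Definition cycle_path c i j : seq 'I_n := rcons (arc c i j) j.

Definition even_chord c e : Prop :=
  chord c e /\ exists i j, [/\ e = [set i; j],
    ~~ odd (size (cycle_path c i j)) & ~~ odd (size (cycle_path c j i))].

Definition odd_chord c e : Prop :=
  chord c e /\ exists i j, [/\ e = [set i; j],
    odd (size (cycle_path c i j)) & odd (size (cycle_path c j i))].

Definition cross c e e' : Prop :=
  [disjoint e & e'] /\ exists i j i' j',
    [/\ e = [set i; j], e' = [set i'; j'],
        i' \in cycle_path c i j & j' \in cycle_path c j i].

Definition bridges c1 c2 : {set {set 'I_n}} :=
  [set e in edges G |
    [exists i, exists j, [&& i \in c1, j \in c2 & e == [set i; j]]]].

End Cycles.

(* Main.v *)
From HB Require Import structures.
From mathcomp Require Import all_boot all_order all_algebra.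
From mathcomp Require Import boolp mpoly zify.
Require Import Defs.

(** Koszulness enters only through the first two maps of the linear resolution.
    They make every syzygy of the generators x_i and u_e t a combination of
    linear syzygies, so that the Rees algebra has no minimal relation of degree
    at least 3.  As the algebra is spanned by monomials, this is a statement on
    factorizations (koszul_fibre_connected): if the generators are cut in two
    classes and every factorization of a given monomial of degree at least 3
    stays inside one class, then all of them stay inside the same class.

    With s = x_1 ... x_n t the generator u_e t is s / (x_p x_q), so a monomial
    is known from its degree k in t and, at each vertex v, the exponent of x_v
    minus the number of edges at v among its k factors u_e t.  A closed walk
    of length 2k then gives two factorizations of one monomial, by its even and
    by its odd steps, because both cover every vertex as often as the walk
    visits it.  Counting degrees shows that the other factorizations contain
    no x_v either: they are the multisets of k edges with the same vertex
    degrees (koszul_walk).  If each of these must alternate along the walk, the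
    even and the odd steps are in different classes, and the algebra is not
    Koszul (koszul_alternating).

    For connectedness, the monomial is x_1 ... x_n t, whose factorizations are
    the products x_p x_q (u_pq t); each of them lies in one component.

    For an even cycle C the multisets are the perfect matchings of the graph
    induced on V(C).  By parity, a matching with an odd chord has a second
    chord that crosses it, so without even chords and without crossing odd
    chords the only matchings are the two of C itself (even_cycle_chord).  If C
    has exactly two chords and they cross, either no matching contains them
    (odd_arcs_obstruction), or each matching that contains them agrees
    elsewhere with the same one of the two matchings of C (ladder_obstruction),
    or they close up an even cycle of length at least 6 with at most one chord
    (detour_obstruction).

    For odd cycles the walk goes around the first one, along a path to the
    second one, around it and back.  If the induced graph has no further edge,
    the degrees force the alternation (no_induced_figure_eight for a common
    vertex, no_induced_dumbbell for a path).  This settles cycles with one common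
    vertex, and disjoint cycles with a single bridge.  If there is no bridge, a
    shortest path between the cycles induces such a dumbbell, unless its first
    or its last inner vertex u has two neighbours on the cycle next to it.  Then
    u lies on a minimal odd cycle that is closer to the other cycle.  By induction there
    are two bridges between these two; they start at u, so u has two neighbours
    on the other cycle as well, and there are two minimal odd cycles that have
    only u in common and no further edge between them
    (double_attachment, two_bridges_path). *)

Set Implicit Arguments.
Unset Strict Implicit.
Unset Printing Implicit Defensive.

Import GRing.Theory.

(** * Linear resolutions and factorizations of monomials *)

Section KoszulFibres.
Local Open Scope ring_scope.
Variables (K : fieldType) (A : comAlgType K) (I : finType) (g : I -> A).

Lemma graded_part1 (a : A) :
  graded_part g 1 a -> exists c : I -> K, a = \sum_y c y *: g y.
Proof.
move=> [c ->]; exists (fun y => c [ffun=> y]).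
rewrite (reindex (fun y => [ffun _ : 'I_1 => y])) /=; last first.
  exists (fun f : {ffun 'I_1 -> I} => f ord0) => [y _|f _]; first by rewrite ffunE.
  by apply/ffunP => i; rewrite ffunE (ord1 i).
by apply: eq_bigr => y _; rewrite big_ord1 ffunE.
Qed.

Variables (M : eqType) (wt : seq I -> M) (coef : M -> {linear A -> K^o}).
Hypothesis coef_mon :
  forall h s, coef h (\prod_(z <- s) g z) = (wt s == h)%:R.
Hypothesis mon_span : forall a : A,
  exists l : seq (K * seq I), a = \sum_(p <- l) p.1 *: \prod_(z <- p.2) g z.
Hypothesis mon_wt :
  forall s s', wt s = wt s' -> \prod_(z <- s) g z = \prod_(z <- s') g z.
Hypothesis wt_size : forall s s', wt s = wt s' -> size s = size s'.
Hypothesis wt_inj : forall y z, wt [:: y] = wt [:: z] -> y = z.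

Lemma coef_scale h k a : coef h (k *: a) = k * coef h a.
Proof. by rewrite linearZ. Qed.

(** Only the constant part of a contributes, by degree. *)
Lemma coef_gen a y z :
  coef (wt [:: y]) (a * g z) = (z == y)%:R * coef (wt [::]) a.
Proof.
have [l ->] := mon_span a.
rewrite mulr_suml !linear_sum /= mulr_sumr; apply: eq_bigr => -[k t] _ /=.
have -> : k *: \prod_(x <- t) g x * g z = k *: \prod_(x <- z :: t) g x.
  by rewrite big_cons -scalerAl mulrC.
rewrite !coef_scale !coef_mon mulrCA; congr (_ * _).
case: t => [|x s].
  rewrite eqxx mulr1; congr (_%:R); congr nat_of_bool.
  by apply/eqP/eqP => [/wt_inj|->].
have -> : (wt (x :: s) == wt [::]) = false by apply/eqP => /wt_size.
by rewrite mulr0; case: eqP => // /wt_size.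
Qed.

(** If l is the column of entries of the first map d 0, then l = L g and g = C l
    with scalar matrices C and L, and C L = 1 because the g z are linearly
    independent: C is the constant part of any matrix that expresses g through
    l.  A syzygy v of g therefore gives the syzygy v C of l, a combination of
    the rows of d 1, and v = (v C) L is the same combination of the rows of
    (d 1) L, which have linear entries. *)
Lemma linear_syzygies : Koszul g -> forall v : I -> A,
  \sum_z v z * g z = 0 ->
  exists (N : nat) (w : 'I_N -> A) (c : 'I_N -> I -> I -> K),
    (forall r, \sum_z (\sum_y c r z y *: g y) * g z = 0)
    /\ forall z, v z = \sum_r w r * \sum_y c r z y *: g y.
Proof.
move=> [b [d [b0 lin aug ex]]] v vg.
have j0 : 'I_(b 0%N) by rewrite b0; exact: ord0.
have jE : forall j : 'I_(b 0%N), j = j0.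
  by move: j0; rewrite b0 => j0 j; rewrite (ord1 j) (ord1 j0).
pose l j := d 0%N j j0.
have /choice [L lE] : forall j, exists c : I -> K, l j = \sum_y c y *: g y.
  by move=> j; exact/graded_part1/lin.
have /choice [D DE] : forall z, exists w : 'rV[A]_(b 1%N),
    g z = \sum_j w 0 j * l j.
  move=> z; have [|w we] := (aug (\row__ g z)).1.
    by move=> j; rewrite mxE; exact: ideal_gen_mem.
  by exists w; move/matrixP/(_ 0 j0): we; rewrite !mxE.
pose C z j := coef (wt [::]) (D z 0 j).
have CL z y : \sum_j C z j * L j y = (z == y)%:R.
  have := congr1 (coef (wt [:: y])) (DE z).
  have -> : coef (wt [:: y]) (g z) = (z == y)%:R.
    have := coef_mon (wt [:: y]) [:: z]; rewrite big_seq1 => ->.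
    by congr (_%:R); congr nat_of_bool; apply/eqP/eqP => [/wt_inj|->].
  move=> ->; rewrite linear_sum; apply: eq_bigr => j _.
  rewrite lE mulr_sumr linear_sum (bigD1 y) //= big1 ?addr0 => [|x /negPf xy].
    by rewrite -scalerAr coef_scale coef_gen eqxx mul1r mulrC.
  by rewrite -scalerAr coef_scale coef_gen xy mul0r mulr0.
have gE z : g z = \sum_j C z j *: l j.
  transitivity (\sum_y (z == y)%:R *: g y).
    rewrite (bigD1 z) //= eqxx scale1r big1 ?addr0 // => y.
    by rewrite eq_sym => /negPf ->; rewrite scale0r.
  under eq_bigr => y _ do rewrite -CL scaler_suml.
  rewrite exchange_big; apply: eq_bigr => j _; rewrite lE scaler_sumr.
  by apply: eq_bigr => y _; rewrite scalerA.
pose u : 'rV[A]_(b 1%N) := \row_j \sum_z C z j *: v z.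
have [|w uw] := (ex 0%N u).1.
  apply/rowP => j; rewrite (jE j) !mxE -{}[RHS]vg.
  under eq_bigr => i _ do rewrite mxE mulr_suml.
  rewrite exchange_big; apply: eq_bigr => z _; rewrite gE mulr_sumr.
  by apply: eq_bigr => i _; rewrite -scalerAl -scalerAr.
have /choice [c cE] : forall r, exists c : 'I_(b 1%N) -> I -> K,
    forall j, d 1%N r j = \sum_y c j y *: g y.
  move=> r; have /choice [c cE] : forall j, exists c : I -> K,
    d 1%N r j = \sum_y c y *: g y by move=> j; exact/graded_part1/lin.
  by exists c.
have SE r z : \sum_y (\sum_j c r j y * L j z) *: g y
            = \sum_j L j z *: d 1%N r j.
  under eq_bigr => y _ do rewrite scaler_suml.
  rewrite exchange_big; apply: eq_bigr => j _; rewrite cE scaler_sumr.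
  by apply: eq_bigr => y _; rewrite scalerA mulrC.
exists (b 2%N), (fun r => w 0 r), (fun r z y => \sum_j c r j y * L j z).
split=> [r|z].
  under eq_bigr => z _ do rewrite SE mulr_suml.
  rewrite exchange_big /=.
  have /rowP/(_ j0) := (ex 0%N (row r (d 1%N))).2
    (ex_intro _ (delta_mx 0 r) (rowE r (d 1%N))).
  rewrite !mxE => {3}<-; apply: eq_bigr => j _; rewrite mxE.
  rewrite -/(l j) lE mulr_sumr; apply: eq_bigr => z _.
  by rewrite -scalerAl -scalerAr.
under eq_bigr => r _ do rewrite SE mulr_sumr.
rewrite exchange_big /=.
transitivity (\sum_j L j z *: u 0 j); last first.
  apply: eq_bigr => j _; rewrite uw mxE scaler_sumr; apply: eq_bigr => r _.
  by rewrite scalerAr.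
under eq_bigr => j _ do rewrite mxE scaler_sumr.
rewrite exchange_big /= (bigD1 z) //= [X in _ + X]big1 ?addr0 => [|y /negPf yz].
  under eq_bigr => j _ do rewrite scalerA mulrC.
  by rewrite -scaler_suml CL eqxx scale1r.
under eq_bigr => j _ do rewrite scalerA mulrC.
by rewrite -scaler_suml CL yz scale0r.
Qed.

(** The syzygy that compares s with s' is a combination of linear ones.  Apply
    to a syzygy v the functional that takes the coefficient of the monomial of s
    in the sum of the v z * g z over z in P only.  On a monomial multiple m of a
    linear syzygy it vanishes: m has a factor, since the degree is at least 3,
    and this factor decides on which side of P all the terms are.  On the
    syzygy of s and s' it would be 1 if s' avoided P. *)
Lemma koszul_fibre_connected : Koszul g ->
  forall (P : pred I) (s s' : seq I),
  (2 < size s)%N -> wt s' = wt s ->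
  (forall r, wt r = wt s -> all P r \/ all (predC P) r) ->
  all P s -> ~~ all (predC P) s'.
Proof.
move=> /linear_syzygies syz P s s' s_gt2 wt_s' onesided Ps.
apply/negP => Ps'; have s'_gt2 : (2 < size s')%N by rewrite (wt_size wt_s').
case: s s_gt2 wt_s' onesided Ps => [|z s] // s_gt2 wt_s' onesided Ps.
case: s' s'_gt2 wt_s' Ps' => [|z' s'] // s'_gt2 wt_s' Ps'.
have Pz : P z by case/andP: Ps.
have Pz' : ~~ P z' by case/andP: Ps'.
set h := wt (z :: s) in onesided wt_s'.
pose v x := (x == z)%:R * (\prod_(y <- s) g y)
          - (x == z')%:R * (\prod_(y <- s') g y).
have sum1 x0 (a : A) (Q : pred I) :
    \sum_(x | Q x) (x == x0)%:R * a * g x = (Q x0)%:R * (a * g x0).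
  case Qx0 : (Q x0).
    rewrite (bigD1 x0) //= eqxx mul1r big1 ?addr0 ?mul1r // => x.
    by case/andP=> _ /negPf ->; rewrite !mul0r.
  rewrite big1 ?mul0r // => x Qx.
  by case: eqP => [xx0|_]; [rewrite xx0 Qx0 in Qx | rewrite !mul0r].
have sumv (Q : pred I) : \sum_(x | Q x) v x * g x
    = (Q z)%:R * (\prod_(y <- z :: s) g y)
      - (Q z')%:R * (\prod_(y <- z' :: s') g y).
  rewrite (eq_bigr (fun x => (x == z)%:R * (\prod_(y <- s) g y) * g x
    - (x == z')%:R * (\prod_(y <- s') g y) * g x)) => [|x _]; last exact: mulrBl.
  by rewrite sumrB !sum1 !big_cons ![g _ * _]mulrC.
have [|N [w [c [c0 vE]]]] := syz v.
  by rewrite (sumv xpredT) (mon_wt wt_s') subrr.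
suff : coef h (\sum_(x | P x) v x * g x) = 0.
  rewrite sumv Pz (negPf Pz') mul0r mul1r subr0 coef_mon eqxx.
  by move/eqP; rewrite oner_eq0.
under eq_bigr => x _ do rewrite vE mulr_suml.
rewrite exchange_big linear_sum big1 // => r _ /=.
have [l ->] := mon_span (w r).
have -> : \sum_(x | P x) (\sum_(p <- l) p.1 *: \prod_(z0 <- p.2) g z0) *
      (\sum_y c r x y *: g y) * g x
   = \sum_(p <- l) p.1 *: \sum_(x | P x)
        \sum_y c r x y *: \prod_(z0 <- x :: y :: p.2) g z0.
  under eq_bigr => x _ do rewrite -mulrA mulr_suml.
  rewrite exchange_big; apply: eq_bigr => i _; rewrite scaler_sumr.
  apply: eq_bigr => x _; rewrite -scalerAl; congr (_ *: _).
  rewrite mulr_suml mulr_sumr; apply: eq_bigr => y _.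
  rewrite -scalerAl -scalerAr; congr (_ *: _).
  by rewrite !big_cons mulrC [g y * g x]mulrC -mulrA.
rewrite linear_sum big1 // => -[k t] _ /=; rewrite coef_scale.
(* The terms of weight h come from factorizations x :: y :: t, each of which
   lies on the side of P of its members from t. *)
case: t => [|x0 t0].
  rewrite linear_sum big1 ?mulr0 // => x _; rewrite linear_sum big1 // => y _.
  rewrite coef_scale coef_mon; case: eqP => [/wt_size sz|_]; last by rewrite mulr0.
  by rewrite -sz in s_gt2.
have side x y : wt [:: x, y, x0 & t0] == h -> P x = P x0.
  by move/eqP/onesided => [] /= /and4P[Px _ Px0 _];
    [rewrite Px Px0 | rewrite (negPf Px) (negPf Px0)].
case Px0 : (P x0); last first.
  rewrite linear_sum big1 ?mulr0 // => x Px; rewrite linear_sum big1 // => y _.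
  rewrite coef_scale coef_mon; case: (boolP (_ == h)) => [/side|_]; last by rewrite mulr0.
  by rewrite Px Px0.
rewrite (_ : coef h _ = 0) ?mulr0 //.
transitivity (coef h (\prod_(y <- x0 :: t0) g y *
    \sum_x (\sum_y c r x y *: g y) * g x)); last by rewrite c0 mulr0 linear0.
rewrite mulr_sumr !linear_sum [RHS](bigID P) /= [X in _ = _ + X]big1 => [|x Px].
  rewrite addr0; apply: eq_bigr => x _; congr (coef h _).
  rewrite mulr_suml mulr_sumr; apply: eq_bigr => y _.
  rewrite -scalerAl -scalerAr; congr (_ *: _); rewrite big_cons big_cons.
  by rewrite [RHS]mulrC [g y * g x]mulrC -mulrA.
rewrite mulr_suml mulr_sumr linear_sum big1 // => y _.
rewrite -scalerAl -scalerAr coef_scale.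
have -> : \prod_(z0 <- x0 :: t0) g z0 * (g y * g x)
        = \prod_(z0 <- [:: x, y, x0 & t0]) g z0.
  by rewrite [RHS]big_cons [in RHS]big_cons mulrC [g y * g x]mulrC -mulrA.
rewrite coef_mon; case: (boolP (_ == h)) => [/side xx0|_]; last by rewrite mulr0.
by rewrite xx0 Px0 in Px.
Qed.
End KoszulFibres.

(** * The Rees algebra as an algebra of monomials *)

Section Spanning.
Local Open Scope ring_scope.
Variables (K : fieldType) (A : comAlgType K) (I : finType) (g : I -> A).

Definition mon_spanned (a : A) :=
  exists l : seq (K * seq I), a = \sum_(p <- l) p.1 *: \prod_(z <- p.2) g z.

Lemma mon_spannedD a b : mon_spanned a -> mon_spanned b -> mon_spanned (a + b).
Proof. by move=> [l ->] [l' ->]; exists (l ++ l'); rewrite big_cat. Qed.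

Lemma mon_spanned_sum J (r : seq J) (Q : pred J) (F : J -> A) :
  (forall j, Q j -> mon_spanned (F j)) -> mon_spanned (\sum_(j <- r | Q j) F j).
Proof.
move=> spF; elim/big_ind: _ => //; last exact: mon_spannedD.
by exists [::]; rewrite big_nil.
Qed.

Lemma mon_spannedZ k a : mon_spanned a -> mon_spanned (k *: a).
Proof.
move=> [l ->]; exists [seq (k * p.1, p.2) | p <- l].
by rewrite big_map scaler_sumr; apply: eq_bigr => p _; rewrite scalerA.
Qed.

Lemma mon_spanned_mon s : mon_spanned (\prod_(z <- s) g z).
Proof. by exists [:: (1, s)]; rewrite big_seq1 scale1r. Qed.

Lemma mon_spannedM a b : mon_spanned a -> mon_spanned b -> mon_spanned (a * b).
Proof.
move=> [l ->] [l' ->]; rewrite mulr_suml; apply: mon_spanned_sum => p _.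
rewrite mulr_sumr; apply: mon_spanned_sum => q _.
rewrite -scalerAl -scalerAr scalerA; apply: mon_spannedZ.
by rewrite -big_cat; exact: mon_spanned_mon.
Qed.

End Spanning.

Section ReesMonomials.
Local Open Scope ring_scope.
Variables (K : fieldType) (n : nat) (G : sgraph n).
Local Notation gen := ('I_n + edge G)%type.
Local Notation rees := (rees K G).
Local Notation g := (@rees_gen K n G).

Definition gen_mnm (z : gen) : 'X_{1..n} :=
  match z with
  | inl i => U_(i)%MM
  | inr e => [multinom (i \notin val e : nat) | i < n]
  end.

Definition is_edge (z : gen) := if z is inr _ then true else false.

(** The monomial in x_1, ..., x_n and t of a product of generators, as its
    exponent vector in the x_i and its degree in t. *)
Definition rees_wt (s : seq gen) : 'X_{1..n} * nat :=
  ((\sum_(z <- s) gen_mnm z)%MM, count is_edge s).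

Lemma compl_monomialE (e : edge G) :
  compl_monomial K e = 'X_[gen_mnm (inr e)].
Proof.
rewrite /compl_monomial mpolyXE_id big_mkcond /=; apply: eq_bigr => i _.
by rewrite mnmE; case: (_ \notin _); rewrite ?expr0 ?expr1.
Qed.

Lemma val_gen z : rees_val (g z) = ('X_[gen_mnm z])%:P * 'X^(is_edge z).
Proof.
case: z => [i|e].
  by rewrite [X in _ * X](_ : _ = 1) ?mulr1 //; exact: expr0.
by rewrite [X in _ * X](_ : _ = 'X) -?compl_monomialE //; exact: expr1.
Qed.

Lemma val_mon s :
  rees_val (\prod_(z <- s) g z) = ('X_[(rees_wt s).1])%:P * 'X^((rees_wt s).2).
Proof.
rewrite /rees_wt /=; elim: s => [|z s IHs]; first by rewrite !big_nil mpolyX0 mul1r expr0.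
rewrite !big_cons.
have -> : rees_val (g z * \prod_(y <- s) g y) = rees_val (g z) * rees_val (\prod_(y <- s) g y).
  by [].
rewrite IHs val_gen.
have -> : count is_edge (z :: s) = (is_edge z + count is_edge s)%N by [].
by rewrite mpolyXD polyCM exprD mulrACA.
Qed.

Lemma mon_rees_wt s s' :
  rees_wt s = rees_wt s' -> \prod_(z <- s) g z = \prod_(z <- s') g z.
Proof.
move=> e; apply: val_inj; apply: (etrans (val_mon s)).
by rewrite e; apply/esym/val_mon.
Qed.

Definition rees_coef (h : 'X_{1..n} * nat) (a : rees) : K^o := (rees_val a)`_h.2@_h.1.

Lemma rees_coef_linear h : linear (rees_coef h).
Proof.
move=> k a b; rewrite /rees_coef.
have -> : rees_val (k *: a + b) = (k%:MP)%:P * rees_val a + rees_val b by [].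
by rewrite coefD coefCM mcoeffD mcoeffCM.
Qed.

HB.instance Definition _ h :=
  GRing.isLinear.Build K rees K^o *:%R (rees_coef h) (rees_coef_linear h).

Lemma rees_coef_mon h s : rees_coef h (\prod_(z <- s) g z) = (rees_wt s == h)%:R.
Proof.
rewrite /rees_coef val_mon coefCM coefXn; case: h => h k /=.
rewrite -pair_eqE /pair_eq /= [k == _]eq_sym.
by case: (_ == k); rewrite /= ?andbT ?andbF ?mulr1 ?mulr0 ?mcoeffX ?mcoeff0.
Qed.

Lemma edge_sub (e : edge G) : #|val e| = 2%N.
Proof. exact: card_edge (valP e). Qed.

(** The monomial x^a t^k has degree |a| - (n - 3) k in the standard grading;
    written without subtraction, and without assuming n >= 3. *)
Lemma mdeg_gen z : (mdeg (gen_mnm z) + 3 * is_edge z = 1 + n * is_edge z)%N.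
Proof.
case: z => [i|e]; first by rewrite /= mdeg1 !muln0.
have -> : mdeg (gen_mnm (inr e)) = #|~: val e|.
  rewrite mdegE -sum1_card [RHS]big_mkcond; apply: eq_bigr => i _.
  by rewrite mnmE inE; case: (_ \in _).
by have := cardsC (val e); rewrite edge_sub card_ord /=; lia.
Qed.

Lemma mdeg_rees_wt s :
  (mdeg (rees_wt s).1 + 3 * (rees_wt s).2 = size s + n * (rees_wt s).2)%N.
Proof.
elim: s => [|z s]; first by rewrite /rees_wt /= big_nil mdeg0 !muln0.
by rewrite /rees_wt /= big_cons mdegD; have := mdeg_gen z; lia.
Qed.

Lemma size_rees_wt s s' : rees_wt s = rees_wt s' -> size s = size s'.
Proof.
by move=> e; have := mdeg_rees_wt s; have := mdeg_rees_wt s'; rewrite e; lia.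
Qed.

Lemma rees_wt_inj y z : rees_wt [:: y] = rees_wt [:: z] -> y = z.
Proof.
move=> yz; have := congr1 fst yz; have := congr1 snd yz.
rewrite /rees_wt /= !big_seq1 !addn0; case: y z {yz} => [i|e] [j|f] //= _.
  by move/(congr1 (fun m : 'X_{1..n} => m j)); rewrite !mnm1E eqxx; case: eqP => // ->.
move=> ef; congr inr; apply: val_inj; apply/setP => i.
have := congr1 (fun m : 'X_{1..n} => m i) ef.
by rewrite !mnmE; do 2!case: (_ \in _).
Qed.

(** Closure properties are proved on values in the polynomial ring, where the
    coefficients of an element can be separated. *)
Definition spanned_val (q : {poly {mpoly K[n]}}) :=
  exists2 a : rees, rees_val a = q & mon_spanned g a.

Lemma spanned_valD p q : spanned_val p -> spanned_val q -> spanned_val (p + q).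
Proof.
by move=> [a <- sa] [b <- sb]; exists (a + b); last exact: mon_spannedD.
Qed.

Lemma spanned_valM p q : spanned_val p -> spanned_val q -> spanned_val (p * q).
Proof.
by move=> [a <- sa] [b <- sb]; exists (a * b); last exact: mon_spannedM.
Qed.

Lemma spanned_val_mon s : spanned_val (rees_val (\prod_(z <- s) g z)).
Proof. by exists (\prod_(z <- s) g z); last exact: mon_spanned_mon. Qed.

Lemma spanned_val1 : spanned_val 1.
Proof. by have := spanned_val_mon [::]; rewrite big_nil. Qed.

Lemma spanned_val0 : spanned_val 0.
Proof. by exists 0 => //; exists [::]; rewrite big_nil. Qed.

Lemma spanned_val_gen z : spanned_val (rees_val (g z)).
Proof. by have := spanned_val_mon [:: z]; rewrite big_seq1. Qed.

Lemma spanned_valC p : spanned_val p%:P.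
Proof.
elim/mpolyind: p => [|c m p _ _ IHp]; first by rewrite polyC0; exact: spanned_val0.
rewrite polyCD; apply: spanned_valD IHp; rewrite -mul_mpolyC polyCM.
apply: spanned_valM.
  by exists (c *: 1); [exact: mulr1 | apply: mon_spannedZ;
    have := mon_spanned_mon g [::]; rewrite big_nil].
rewrite mpolyXE_id rmorph_prod.
elim/big_ind: _ => [|p' q|i _]; [exact: spanned_val1 | exact: spanned_valM |].
rewrite rmorphXn /=; elim: (m i) => [|k IHk].
  by rewrite expr0; exact: spanned_val1.
rewrite exprS; apply: spanned_valM IHk; exact: (spanned_val_gen (inl i)).
Qed.

Lemma spanned_val_sum (J : finType) (F : J -> {poly {mpoly K[n]}}) :
  (forall j, spanned_val (F j)) -> spanned_val (\sum_j F j).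
Proof.
by move=> sF; elim/big_ind: _ => //; [exact: spanned_val0 | exact: spanned_valD].
Qed.

Lemma rees_spanned (a : rees) : mon_spanned g a.
Proof.
suff [b /val_inj <-] : spanned_val (rees_val a) by [].
have aR : forall k, ideal_exp (@compl_edge_ideal K n G) k (rees_val a)`_k.
  exact/in_reesP/(valP a).
rewrite -[rees_val a]coefK poly_def; apply: spanned_val_sum => k.
have [m [c [f [Jf ->]]]] := aR k.
rewrite -mul_polyC raddf_sum /= mulr_suml.
apply: spanned_val_sum => i; rewrite polyCM -mulrA; apply: spanned_valM (spanned_valC _) _.
have -> : 'X^k = \prod_(j < k) 'X :> {poly {mpoly K[n]}}.
  by rewrite prodr_const card_ord.
rewrite rmorph_prod /= -big_split.
elim/big_ind: _ => [|p q|j _]; [exact: spanned_val1 | exact: spanned_valM |].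
have [d ->] := Jf i j.
rewrite raddf_sum /= mulr_suml.
apply: spanned_val_sum => e; rewrite polyCM -mulrA; apply: spanned_valM (spanned_valC _) _.
exact: (spanned_val_gen (inr e)).
Qed.

(** A disconnected fibre obstructs Koszulness: its two sides would give a
    minimal relation of degree at least 3. *)
Lemma rees_fibre_connected : Koszul g ->
  forall (P : pred gen) (s s' : seq gen),
  (2 < size s)%N -> rees_wt s' = rees_wt s ->
  (forall r, rees_wt r = rees_wt s -> all P r \/ all (predC P) r) ->
  all P s -> ~~ all (predC P) s'.
Proof.
apply: (@koszul_fibre_connected K rees gen g _ rees_wt
  (fun h => rees_coef h : {linear rees -> K^o})).
- exact: rees_coef_mon.
- exact: rees_spanned.
- exact: mon_rees_wt.
- exact: size_rees_wt.
- exact: rees_wt_inj.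
Qed.

End ReesMonomials.

(** * Walks, their steps, and the fibres they define *)

Section Alternate.
Variable T : eqType.
Implicit Types (b : bool) (l : seq T).

(** Every second entry of l, from the first one if b holds and from the second
    one otherwise. *)
Fixpoint alternate b l : seq T :=
  if l is a :: l' then
    if b then a :: alternate (~~ b) l' else alternate (~~ b) l'
  else [::].

Lemma mem_alternate l e :
  (e \in l) = (e \in alternate true l) || (e \in alternate false l).
Proof. by elim: l => //= a l IHl; rewrite !inE IHl orbAC -orbA. Qed.

Lemma alternate_sorted (a : pred T) l :
  sorted (fun e f => a e != a f) l ->
  exists b, {in alternate true l, forall e, a e = b}
         /\ {in alternate false l, forall e, a e = ~~ b}.
Proof.
case: l => [|e l]; first by exists true.
elim: l e => [|f l IHl] e /=.
  by exists (a e); split=> // x; rewrite inE => /eqP ->.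
case/andP=> ef /IHl [b [Ht Hf]]; exists (~~ b); split=> x.
  rewrite inE => /predU1P[->|/Hf //].
  by have := Ht f (mem_head _ _); move: ef; case: (a e) (a f) b {Ht Hf} => [] [] [].
by rewrite negbK => /Ht.
Qed.

Lemma alternate_cat b l1 l2 : alternate b (l1 ++ l2)
  = alternate b l1 ++ alternate (b (+) odd (size l1)) l2.
Proof.
elim: l1 b => [|a l1 IHl] b /=; first by rewrite addbF.
by case: b; rewrite IHl addbN ?addNb ?addTb ?addFb ?negbK.
Qed.

Lemma size_alternate l : size (alternate true l) = uphalf (size l)
                      /\ size (alternate false l) = (size l)./2.
Proof. by elim: l => //= a l [-> ->]. Qed.

End Alternate.

Section Walks.
Variables (n : nat) (G : sgraph n).
Implicit Types (x y v : 'I_n) (p : seq 'I_n) (e : {set 'I_n}).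
Implicit Types E : seq {set 'I_n}.

(** The edges of the walk that starts at x and visits p in turn. *)
Definition steps x p : seq {set 'I_n} := pairmap (fun a b => [set a; b]) x p.

Definition deg E v := count (fun e => v \in e) E.

Lemma adj_neq x y : adj G x y -> x != y.
Proof. by move/card_edge; rewrite cards2; case: eqP. Qed.

Lemma adjC : ssrbool.symmetric (adj G).
Proof. by move=> x y; rewrite /adj setUC. Qed.

Lemma edge_pair e : e \in edges G -> exists x y, e = [set x; y] /\ x != y.
Proof. by move=> /card_edge/eqP/cards2P[x [y [xy ->]]]; exists x, y. Qed.

Lemma sum_deg E : {subset E <= edges G} -> \sum_v deg E v = (size E).*2.
Proof.
elim: E => [|e E IHE] EG; first by rewrite big1.
rewrite big_split /= IHE => [|f fE]; last by apply: EG; rewrite inE fE orbT.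
rewrite (_ : \sum_v (v \in e) = 2) //.
by rewrite -(card_edge (EG e (mem_head _ _))) -sum1_card [RHS]big_mkcond.
Qed.

(** Each visit of an inner vertex is between two consecutive steps, one of which
    is selected; the two ends of the walk may lack theirs. *)
Lemma deg_alternate b x p v : path (adj G) x p ->
  deg (alternate b (steps x p)) v + ~~ b * (x == v)
    + (b (+) odd (size p)) * (last x p == v) = count_mem v (x :: p).
Proof.
elim: p x b => [|y p IHp] x b /=; first by case: b => /=; lia.
case/andP=> xy /IHp IH; have nxy := adj_neq xy.
have vxy : (v \in [set x; y]) = (x == v) + (y == v) :> nat.
  rewrite !inE ![v == _]eq_sym; case: eqP => [<-|]; last by case: eqP.
  by rewrite eq_sym (negPf nxy).
have := IH (~~ b); case: b => /=; rewrite /deg /= ?vxy;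
  by case: (odd (size p)) => /=; lia.
Qed.

Lemma deg_alternate_closed b x p v : path (adj G) x p -> last x p = x ->
  ~~ odd (size p) -> deg (alternate b (steps x p)) v = count_mem v p.
Proof.
move=> pp lp /negPf evp; have := deg_alternate b v pp.
by rewrite lp evp addbF /=; case: b => /=; lia.
Qed.

Lemma steps_edges x p : path (adj G) x p -> {subset steps x p <= edges G}.
Proof.
elim: p x => //= y p IHp x /andP[xy pp] e; rewrite inE => /predU1P[->//|].
exact: IHp.
Qed.

Lemma size_steps x p : size (steps x p) = size p.
Proof. exact: size_pairmap. Qed.

End Walks.

Section Fibres.
Variables (K : fieldType) (n : nat) (G : sgraph n).
Local Notation gen := ('I_n + edge G)%type.
Implicit Types (r : seq gen) (v : 'I_n) (E : seq {set 'I_n}).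
Hypothesis koszulG : Koszul (@rees_gen K n G).

Definition edges_of r : seq {set 'I_n} :=
  pmap (fun z : gen => if z is inr e then Some (val e) else None) r.

Lemma edges_of_sub r : {subset edges_of r <= edges G}.
Proof.
move=> e; rewrite mem_pmap => /mapP[[i|f] _ //= [->]]; exact: valP.
Qed.

(** The exponent of x_v counts the edges that avoid v, so together with the
    edges at v it counts all of them. *)
Lemma rees_wt_deg r v : (rees_wt r).1 v + deg (edges_of r) v
  = count_mem (inl v) r + size (edges_of r).
Proof.
rewrite /rees_wt /=; elim: r => [|z r IHr]; first by rewrite big_nil mnm0E.
rewrite big_cons mnmDE /=; case: z => [i|e] /=.
  rewrite mnm1E; have -> : (inl i == inl v :> gen) = (i == v) by [].
  by lia.
by rewrite mnmE /deg /=; move: IHr; rewrite /deg; case: (v \in _) => /=; lia.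
Qed.

Lemma rees_wt_size r : (rees_wt r).2 = size (edges_of r).
Proof. by elim: r => //= -[i|e] r /= ->. Qed.

Lemma edge_lift E : {subset E <= edges G} ->
  exists L : seq (edge G), E = map val L.
Proof.
elim: E => [|e E IHE] EG; first by exists [::].
have [|L ->] := IHE; first by move=> f fE; apply: EG; rewrite inE fE orbT.
by exists (Sub e (EG e (mem_head _ _)) :: L).
Qed.

Lemma edges_of_lift (L : seq (edge G)) : edges_of (map inr L) = map val L.
Proof. by rewrite /edges_of; elim: L => //= e L ->. Qed.

(** A factorization of a product of generators u_e t contains no variable x_v:
    it has as many edges, hence the same sum of vertex degrees, and each x_v
    would have to be compensated by an additional edge end at v. *)
Lemma rees_wt_lift (L : seq (edge G)) r : rees_wt r = rees_wt (map inr L) ->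
  (forall v, inl v \notin r) /\ (forall v, deg (edges_of r) v = deg (map val L) v).
Proof.
move=> wtr.
have noinl v : count_mem (inl v : gen) (map inr L) = 0.
  by apply/count_memPn/mapP => -[].
have sz : size (edges_of r) = size (map val L).
  by rewrite -rees_wt_size wtr rees_wt_size edges_of_lift.
have dE v : deg (edges_of r) v = count_mem (inl v) r + deg (map val L) v.
  have := rees_wt_deg r v; have := rees_wt_deg (map inr L) v.
  by rewrite wtr edges_of_lift noinl sz; lia.
have : \sum_v count_mem (inl v : gen) r = 0.
  have LG : {subset map val L <= edges G} by move=> e /mapP[f _ ->]; exact: valP.
  have := sum_deg (@edges_of_sub r).
  rewrite (eq_bigr _ (fun v _ => dE v)) big_split /= (sum_deg LG) sz.
  by move/eqP; rewrite -[X in _ == X]add0n eqn_add2r => /eqP.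
move/eqP; rewrite sum_nat_eq0 => /forallP r0.
have {}r0 v : count_mem (inl v : gen) r = 0 by apply/eqP; exact: r0.
by split=> v; [apply/count_memPn | rewrite dE r0].
Qed.

(** The even and the odd steps of an even closed walk are two factorizations of
    one monomial.  The bound on the length makes its degree at least 3. *)
Lemma koszul_walk x p (P : pred {set 'I_n}) :
  path (adj G) x p -> last x p = x -> ~~ odd (size p) -> 6 <= size p ->
  (forall E, {subset E <= edges G} -> (forall v, deg E v = count_mem v p) ->
     all P E \/ all (predC P) E) ->
  all P (alternate true (steps x p)) ->
  ~~ all (predC P) (alternate false (steps x p)).
Proof.
move=> pp lp evp szp homo Pt.
have sub b : {subset alternate b (steps x p) <= edges G}.
  move=> e eb; apply: (steps_edges pp); rewrite mem_alternate.
  by case: b eb => ->; rewrite ?orbT.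
have [Lt Et] := edge_lift (sub true); have [Lf Ef] := edge_lift (sub false).
have degp b v := deg_alternate_closed b v pp lp evp.
(* The value on the variables is arbitrary: they do not occur. *)
pose P' (z : gen) := if z is inr e then P (val e) else true.
have szE : size (alternate true (steps x p)) = size (alternate false (steps x p)).
  have [-> ->] := size_alternate (steps x p).
  by rewrite size_steps uphalf_half (negPf evp).
have szt : 2 < size (alternate true (steps x p)).
  by have [-> _] := size_alternate (steps x p); rewrite size_steps; lia.
have := @rees_fibre_connected K n G koszulG P' (map inr Lt) (map inr Lf).
rewrite !all_map size_map -(size_map val) -Et szt Ef Et in Pt *.
rewrite !all_map in Pt *; apply=> //; last first.
  move=> r /rees_wt_lift [noinl dr]; have [||Pr|Pr] := homo (edges_of r).
  - exact: edges_of_sub.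
  - by move=> v; rewrite dr -Et degp.
  - left; apply/allP => -[i|e] // er; apply: (allP Pr).
    by rewrite mem_pmap; apply/mapP; exists (inr e).
  - right; apply/allP => -[i|e] er; first by rewrite (negPf (noinl i)) in er.
    by apply: (allP Pr); rewrite mem_pmap; apply/mapP; exists (inr e).
have sE : size (map val Lf) = size (map val Lt) by rewrite -Et -Ef.
have e2 : (rees_wt (map inr Lf : seq gen)).2 = (rees_wt (map inr Lt : seq gen)).2.
  by rewrite !rees_wt_size !edges_of_lift.
rewrite [LHS]surjective_pairing [RHS]surjective_pairing e2; congr pair.
apply/mnmP => v; have := rees_wt_deg (map inr Lf) v.
have := rees_wt_deg (map inr Lt) v; rewrite !edges_of_lift -Et -Ef !degp szE.
have noinl L : count_mem (inl v : gen) (map inr L) = 0.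
  by apply/count_memPn/mapP => -[].
by rewrite !noinl => <- /addIn.
Qed.

(** If consecutive steps are always separated by E, then E is the set of the even
    steps or that of the odd steps.  Applied to the even steps themselves, the
    hypothesis also shows that no edge is at once an even and an odd step. *)
Lemma koszul_alternating x p :
  path (adj G) x p -> last x p = x -> ~~ odd (size p) -> 6 <= size p ->
  ~ (forall E, {subset E <= edges G} -> (forall v, deg E v = count_mem v p) ->
     {subset E <= steps x p}
     /\ sorted (fun e f => (e \in E) != (f \in E)) (steps x p)).
Proof.
move=> pp lp evp szp alt.
have sub : {subset alternate true (steps x p) <= edges G}.
  by move=> e et; apply: (steps_edges pp); rewrite mem_alternate et.
have [_ /alternate_sorted [b [bt bf]]] := 
  alt _ sub (fun v => deg_alternate_closed true v pp lp evp).
have b1 : b = true.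
  case: p szp bt {pp lp evp alt sub bf} => // y p _ bt.
  by rewrite -(bt _ (mem_head _ _)) mem_head.
have /(_ _ _)/negP := @koszul_walk x p (mem (alternate true (steps x p))) pp lp evp szp.
apply=> [E EG degE||].
- have [EW /alternate_sorted [c [ct cf]]] := alt E EG degE.
  case: c in ct cf; [left|right]; apply/allP => e eE /=.
    by have := EW e eE; rewrite mem_alternate => /orP[//|/cf]; rewrite eE.
  by apply/negP => /ct; rewrite eE.
- exact/allP.
- by apply/allP => e /bf /=; rewrite b1 => ->.
Qed.

(** All the monomials x_p x_q (u_pq t) are equal to x_1 ... x_n t, and these are
    its only factorizations; each of them stays in one component of G. *)
Lemma koszul_connected e f x y : e \in edges G -> f \in edges G ->
  x \in e -> y \in f -> connect (adj G) x y.
Proof.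
move=> eG fG xe yf; apply/negPn/negP => nxy.
have csym := sym_connect_sym (@adjC n G).
pose in_comp (h : {set 'I_n}) := [exists i in h, connect (adj G) x i].
pose P (z : gen) := match z with
  | inl i => connect (adj G) x i | inr h => in_comp (val h) end.
have in_compE h i : h \in edges G -> i \in h -> in_comp h = connect (adj G) x i.
  move=> hG ih; apply/exists_inP/idP => [[j jh xj]|]; last by exists i.
  have [a [b [hab _]]] := edge_pair hG.
  have ab : adj G a b by rewrite /adj -hab.
  have := same_connect_r csym (connect1 ab) x => xab.
  by move: ih jh xj; rewrite hab !inE => /orP[] /eqP -> /orP[] /eqP -> //; rewrite xab.
pose fact h (hG : h \in edges G) : seq gen :=
  rcons [seq inl i | i <- enum h] (inr (Sub h hG)).
have edges_fact h hG : edges_of (@fact h hG) = [:: h].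
  by rewrite /fact /edges_of -cats1 pmap_cat /=; elim: (enum h) => //= a l ->.
have count_fact h hG v : count_mem (inl v) (@fact h hG) = (v \in h).
  rewrite /fact -cats1 count_cat /= !addn0 count_map -(mem_enum h).
  by rewrite -(count_uniq_mem _ (enum_uniq h)); exact: eq_count.
have wt_fact h hG : (rees_wt (@fact h hG)).2 = 1
    /\ forall v, (rees_wt (@fact h hG)).1 v = 1.
  split=> [|v]; first by rewrite rees_wt_size edges_fact.
  have := rees_wt_deg (fact h hG) v.
  by rewrite edges_fact count_fact /deg /= addn0 addnC => /addnI.
have wt_eq h hG h' hG' : rees_wt (@fact h hG) = rees_wt (@fact h' hG').
  rewrite [LHS]surjective_pairing [RHS]surjective_pairing.
  have [-> w1] := wt_fact h hG; have [-> w2] := wt_fact h' hG'.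
  by congr pair; apply/mnmP => v; rewrite w1 w2.
have P_fact h hG : all (fun z => P z == in_comp h) (@fact h hG).
  rewrite /fact all_rcons /= eqxx all_map; apply/allP => i.
  by rewrite mem_enum => ih; rewrite /= (in_compE h i).
apply: (negP (@rees_fibre_connected K n G koszulG P (fact e eG) (fact f fG)
  _ _ _ _)) => [||r wtr||].
- by rewrite size_rcons size_map -cardE (card_edge eG).
- exact: wt_eq.
- have := rees_wt_size r; rewrite wtr (wt_fact e eG).1.
  case er : (edges_of r) => [|h []] // _.
  have hG : h \in edges G by apply: (@edges_of_sub r h); rewrite er mem_head.
  suff /allP Ph : all (fun z => P z == in_comp h) r.
    by case hc : (in_comp h) Ph => Ph; [left|right]; apply/allP => z /Ph /=;
      move/eqP->.
  apply/allP => -[v|g'] zr.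
    rewrite /= (in_compE h v) //.
    have := rees_wt_deg r v; rewrite wtr (wt_fact e eG).2 er /deg /= addn0.
    have : 0 < count_mem (inl v : gen) r by rewrite -has_count has_pred1.
    case: (v \in h) => // c0 /eqP; rewrite addnC eqn_add2r => /eqP c1.
    by have : 0 < false by rewrite [X in _ < X]c1; exact: c0.
  have : val g' \in edges_of r by rewrite mem_pmap; apply/mapP; exists (inr g').
  by rewrite er inE => /eqP gh; rewrite /= gh.
- apply/allP => z /(allP (P_fact e eG))/eqP ->.
  by rewrite (in_compE e x) // connect0.
- apply/allP => z /(allP (P_fact f fG))/eqP /= ->.
  by rewrite (in_compE f y).
Qed.
End Fibres.

(** * Propagation of degree conditions along a walk *)

(** Case analysis on all the memberships and equalities of vertices in the goal;
    the distinctness of the vertices of a walk is available as a bound by 1 on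
    the number of places where a vertex occurs. *)
Local Ltac decide_mem :=
  repeat match goal with
  | |- context [@in_mem ?T ?x ?A] => case: (@in_mem T x A)
  | |- context [(?x == ?y :> ordinal _)] => case: (x == y)
  end; by [].

Section Balance.
Variable (n : nat) (E : seq {set 'I_n}).
Implicit Types (x y z v : 'I_n) (p q : seq 'I_n) (e f : {set 'I_n}).
Implicit Types N l : seq {set 'I_n}.

Lemma steps_cat x p q : steps x (p ++ q) = steps x p ++ steps (last x p) q.
Proof. exact: pairmap_cat. Qed.

Lemma steps_rcons x p y :
  steps x (rcons p y) = rcons (steps x p) [set last x p; y].
Proof. by rewrite -cats1 steps_cat cats1. Qed.

Lemma mem_steps x p e v : e \in steps x p -> v \in e -> v \in x :: p.
Proof.
elim: p x => //= y p IHp x; rewrite inE => /predU1P[->|ep /(IHp _ ep)].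
  by rewrite !inE => /orP[] ->; rewrite ?orbT.
by rewrite !inE => ->; rewrite orbT.
Qed.

Lemma steps_head x y p e : x \notin y :: p ->
  e \in steps x (y :: p) -> x \in e -> e = [set x; y].
Proof.
move=> xp; rewrite /= inE => /predU1P[//|ep] /(mem_steps ep).
by rewrite (negPf xp).
Qed.

Lemma steps_last x p z e : z \notin x :: p ->
  e \in steps x (rcons p z) -> z \in e -> e = [set last x p; z].
Proof.
move=> zp; rewrite steps_rcons mem_rcons inE => /predU1P[//|ep] /(mem_steps ep).
by rewrite (negPf zp).
Qed.

Lemma rev_steps x p : steps (last x p) (rev (belast x p)) = rev (steps x p).
Proof.
elim: p x => //= y p IHp x; rewrite !rev_cons steps_rcons IHp; congr rcons.
suff -> : last (last y p) (rev (belast y p)) = y by rewrite setUC.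
by case: p {IHp} => //= z p; rewrite rev_cons last_rcons.
Qed.

Lemma set2_inj x y z : [set x; y] = [set x; z] -> y = z.
Proof.
move=> yz; have : y \in [set x; z] by rewrite -yz !inE eqxx orbT.
have : z \in [set x; y] by rewrite yz !inE eqxx orbT.
by rewrite !inE => /orP[] /eqP -> /orP[] /eqP.
Qed.

Lemma deg_gt0 v : (0 < deg E v) = has (fun e => v \in e) E.
Proof. by rewrite has_count. Qed.

Lemma deg_mem N v : uniq N -> {in N, forall e, v \in e} ->
  {in E, forall e, v \in e -> e \in N} ->
  deg E v = \sum_(e <- N) count_mem e E.
Proof.
move=> uN Nv; rewrite /deg; elim: E => [|e E' IHE] EN; first by rewrite big1.
rewrite big_split /= -IHE => [|f fE]; last by apply: EN; rewrite inE fE orbT.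
congr (_ + _); have -> : (v \in e) = (e \in N).
  by apply/idP/idP => [/EN|/Nv //]; apply; rewrite mem_head.
rewrite -(count_uniq_mem _ uN) -sum1_count big_mkcond.
by apply: eq_bigr => f _; rewrite /= eq_sym; case: eqP.
Qed.


(** An inner vertex of degree d whose edges in E are among the two steps around
    it distributes d between them.  The walk may be closed (x = z). *)
Lemma balanced_steps d x q z : uniq (x :: q) -> z \notin q ->
  (x != z) || (1 < size q) -> {in q, forall y, deg E y = d} ->
  {in E, forall e, {in q, forall y, y \in e -> e \in steps x (rcons q z)}} ->
  sorted (fun e f => count_mem e E + count_mem f E == d) (steps x (rcons q z)).
Proof.
elim: q x => // y q IHq x /= /andP[xq uq] zq xz dq Eq.
have [yx yq] : y != x /\ x \notin q.
  by move: xq; rewrite inE negb_or eq_sym => /andP.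
have yz : y != z by move: zq; rewrite inE negb_or eq_sym => /andP[].
have zq' : z \notin q by move: zq; rewrite inE negb_or => /andP[].
have E_q : {in E, forall e, {in q, forall u, u \in e -> e \in steps y (rcons q z)}}.
  move=> e eE u uq' ue; have := Eq e eE u; rewrite !inE uq' orbT => /(_ isT ue).
  case/predU1P=> // exy; move: ue; rewrite exy !inE => /orP[] /eqP uE.
    by rewrite -uE uq' in yq.
  by move: uq; rewrite -uE uq'.
have {IHq} := IHq y uq zq'; rewrite yz => /(_ isT) IHq.
have {IHq} := IHq (fun u uq' => dq u (mem_behead (s := y :: q) uq')) E_q.
have := Eq; case eq_q : (rcons q z) => [|w m] /=; first by case: (q) eq_q.
move=> Exy ->; rewrite andbT; have ymw : y \notin w :: m.
  by rewrite -eq_q mem_rcons inE negb_or yz; case/andP: uq.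
have xw : x != w.
  case: q eq_q xz yq {uq zq dq Eq zq' E_q Exy xq} => [|q0 q] /= [<- _].
    by rewrite orbF.
  by rewrite inE negb_or => _ /andP[].
rewrite -(dq y (mem_head _ _)) (@deg_mem [:: [set x; y]; [set y; w]] y).
- by rewrite !big_cons big_nil addn0.
- rewrite /= andbT inE; apply/eqP; rewrite setUC => /set2_inj xw'.
  by rewrite xw' eqxx in xw.
- by move=> e; rewrite !inE => /orP[] /eqP ->; rewrite !inE eqxx ?orbT.
- move=> e eE ye; have := Exy e eE y (mem_head _ _) ye; rewrite !inE.
  case/or3P=> [-> //|->|em]; first by rewrite orbT.
  by have := mem_steps em ye; rewrite (negPf ymw).
Qed.

Definition separates e f := (e \in E) != (f \in E).

Lemma mem_count e : (e \in E) = (0 < count_mem e E).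
Proof. by rewrite -has_count has_pred1. Qed.

Lemma balanced1_separates l :
  sorted (fun e f => count_mem e E + count_mem f E == 1) l -> sorted separates l.
Proof.
apply: sub_sorted => e f; rewrite /separates !mem_count.
by case: (count_mem e E) (count_mem f E) => [|[]] [|[]].
Qed.

(** When two consecutive multiplicities add up to 2, the first one being 0 or 2
    forces 0 and 2 to alternate; the solution 1, 1, 1, ... is excluded only by
    the hypothesis on the first step. *)
Lemma balanced2_separates e l : count_mem e E != 1 ->
  path (fun e f => count_mem e E + count_mem f E == 2) e l ->
  path separates e l /\ count_mem (last e l) E != 1.
Proof.
elim: l e => //= f l IHl e e1 /andP[ef fl].
have [|-> ->] := IHl f _ fl; first by move: e1 ef; lia.
split=> //; rewrite andbT /separates !mem_count; move: e1 ef.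
by case: (count_mem e E) (count_mem f E) => [|[|[|a]]] [|[|[|b]]].
Qed.

Lemma separates_last e l :
  path separates e l -> (last e l \in E) = (e \in E) (+) odd (size l).
Proof.
elim: l e => [|f l IHl] e /=; first by rewrite addbF.
by case/andP=> ef /IHl ->; rewrite /separates in ef; case: (e \in E) (f \in E) (odd _) ef => [] [] [].
Qed.

Lemma separates_sym : ssrbool.symmetric separates.
Proof. by move=> e f; rewrite /separates eq_sym. Qed.

End Balance.

(** * Two odd cycles joined at a vertex or by a path *)

Section Loop.
Variable (n : nat) (E : seq {set 'I_n}).
Implicit Types (x y z v : 'I_n) (p q : seq 'I_n) (e f : {set 'I_n}).

(** At each vertex but v exactly one of the two steps around it is in E, and the
    number of steps is odd; so the first and the last step, which meet at v,
    are both in E or both outside. *)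
Lemma odd_loop v q : uniq (v :: q) -> ~~ odd (size q) -> 1 < size q ->
  {in q, forall y, deg E y = 1} ->
  {in E, forall e, {in q, forall y, y \in e -> e \in steps v (rcons q v)}} ->
  exists e f l, [/\ steps v (rcons q v) = e :: rcons l f, e != f,
    path (separates E) e (rcons l f), (f \in E) = (e \in E)
    & {in steps v (rcons q v), forall h : {set 'I_n}, (v \in h) = (h \in [:: e; f])}].
Proof.
move=> uvq evq szq dq Eq; have [vq uq] := andP uvq.
have := balanced1_separates (balanced_steps uvq vq (introT orP (or_intror szq)) dq Eq).
case: q evq szq vq {dq Eq uvq uq} (uq) => // a q; case/lastP: q => // q b.
rewrite /= size_rcons /= negbK => evq _.
rewrite inE mem_rcons inE !negb_or => /and3P[va vb vq] /andP[+ _].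
rewrite mem_rcons inE negb_or => /andP[ab _].
rewrite steps_rcons last_rcons => sep.
exists [set v; a], [set b; v], (steps a (rcons q b)); split=> //.
- apply/eqP; rewrite [in RHS]setUC => /set2_inj ab'; by rewrite ab' eqxx in ab.
- by have := separates_last sep; rewrite last_rcons size_rcons size_steps size_rcons /=
    negbK (negPf evq) addbF.
- move=> h; rewrite !inE mem_rcons inE => /or3P[/eqP->|/eqP->|hl].
  + by rewrite !inE !eqxx.
  + by rewrite !inE !eqxx !orbT.
  have vh : v \notin h.
    by apply/negP => /(mem_steps hl); rewrite inE mem_rcons inE (negPf va) (negPf vb) (negPf vq).
  rewrite (negPf vh); apply/esym/negP => /orP[] /eqP hE; move: vh;
    by rewrite hE !inE eqxx ?orbT.
Qed.
End Loop.

(** With a, b the multiplicities of the two edges at v of one loop and c, d those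
    of the other one: exactly one loop supplies both edges at v. *)
Lemma two_loops_mult a b c d : a + (b + (c + d)) = 2 ->
  (0 < b) = (0 < a) -> (0 < d) = (0 < c) -> (0 < b) != (0 < c).
Proof. by case: a b c d => [|a] [|b] [|c] [|d] //=; lia. Qed.

(** With c the multiplicity of the step by which a path leaves a loop: either the
    loop supplies both edges at the vertex, or the path is used twice. *)
Lemma loop_path_mult a b c : c + (a + b) = 2 -> (0 < b) = (0 < a) ->
  c != 1 /\ (0 < b) != (0 < c).
Proof. by case: a b c => [|a] [|b] [|[|c]] //=; lia. Qed.

Section TwoOddCycles.
Variables (K : fieldType) (n : nat) (G : sgraph n).
Implicit Types (x y z v w : 'I_n) (p q : seq 'I_n) (e f : {set 'I_n}).
Hypothesis koszulG : Koszul (@rees_gen K n G).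

(** The vertex v, of degree 2, takes both its edges from the same cycle, and the
    degree 1 elsewhere makes the membership alternate along both cycles. *)
Lemma no_induced_figure_eight v q1 q2 :
  path (adj G) v (rcons q1 v) -> ~~ odd (size q1) -> 1 < size q1 ->
  path (adj G) v (rcons q2 v) -> ~~ odd (size q2) -> 1 < size q2 ->
  uniq (v :: q1 ++ q2) ->
  ~ {in edges G, forall e, {subset e <= v :: q1 ++ q2} ->
       e \in steps v (rcons q1 v) ++ steps v (rcons q2 v)}.
Proof.
move=> p1 ev1 sz1 p2 ev2 sz2 uv H.
have := uv; rewrite cons_uniq => /andP[vq uq]; move: vq; rewrite mem_cat negb_or => /andP[vq1 vq2].
move: uq; rewrite cat_uniq => /and3P[uq1 /hasPn q12 uq2].
apply: (koszul_alternating koszulG (x := v) (p := rcons q1 v ++ rcons q2 v)).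
- by rewrite cat_path last_rcons p1.
- by rewrite last_cat !last_rcons.
- by rewrite size_cat !size_rcons oddD /= (negPf ev1) (negPf ev2).
- by rewrite size_cat !size_rcons; lia.
move=> E EG degE; rewrite steps_cat last_rcons.
have cnt y : count_mem y (rcons q1 v ++ rcons q2 v)
    = (y \in q1) + (y \in q2) + (y == v).*2.
  rewrite -!cats1 !count_cat /= !addn0 !count_uniq_mem // ![v == _]eq_sym -addnn.
  by rewrite addnACA.
have EW : {subset E <= steps v (rcons q1 v) ++ steps v (rcons q2 v)}.
  move=> e eE; apply: H; first exact: EG.
  move=> u ue; have : 0 < deg E u by rewrite deg_gt0; apply/hasP; exists e.
  by rewrite degE -has_count has_pred1 mem_cat !mem_rcons !inE mem_cat;
    case: (u == v); case: (u \in q1).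
split=> //.
have nin y : y \in q1 -> y \notin q2.
  by move=> y1; apply/negP => /q12; rewrite /= y1.
have [|||||e1 [f1 [l1 [s1 n1 sep1 ef1 v1]]]] := @odd_loop n E v q1.
- by rewrite /= vq1.
- by [].
- by [].
- move=> y y1; rewrite degE cnt y1 (negPf (nin y y1)).
  by case: eqP => // yv; rewrite -yv y1 in vq1.
- move=> e eE y y1 ye; have := EW e eE; rewrite mem_cat => /orP[//|].
  move/mem_steps/(_ ye); rewrite inE mem_rcons inE (negPf (nin y y1)) orbF orbb.
  by move/eqP => yv; rewrite -yv y1 in vq1.
have [|||||e2 [f2 [l2 [s2 n2 sep2 ef2 v2]]]] := @odd_loop n E v q2.
- by rewrite /= vq2.
- by [].
- by [].
- move=> y y2; rewrite degE cnt y2.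
  have -> : (y \in q1) = false by apply/negP => /nin; rewrite y2.
  by case: eqP => // yv; rewrite -yv y2 in vq2.
- move=> e eE y y2 ye; have := EW e eE; rewrite mem_cat => /orP[|//].
  move/mem_steps/(_ ye); rewrite inE mem_rcons inE.
  have -> : (y \in q1) = false by apply/negP => /nin; rewrite y2.
  by rewrite orbF orbb => /eqP yv; rewrite -yv y2 in vq2.
have disj h : h \in steps v (rcons q1 v) -> h \notin steps v (rcons q2 v).
  move=> h1; apply/negP => h2.
  have hv y : y \in h -> y = v.
    move=> yh; move: (mem_steps h1 yh) (mem_steps h2 yh).
    rewrite !inE !mem_rcons !inE; case: eqP => //= _ /nin; by move/negPf->.
  have [a [b [hE ab]]] := edge_pair (steps_edges p1 h1).
  move: ab; have -> : a = v by apply: hv; rewrite hE !inE eqxx.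
  have -> : b = v by apply: hv; rewrite hE !inE eqxx orbT.
  by rewrite eqxx.
have in1 h : h \in [:: e1; f1] -> h \in steps v (rcons q1 v).
  by rewrite s1 !inE mem_rcons inE => /orP[] ->; rewrite ?orbT.
have in2 h : h \in [:: e2; f2] -> h \in steps v (rcons q2 v).
  by rewrite s2 !inE mem_rcons inE => /orP[] ->; rewrite ?orbT.
(* The degree 2 of v is shared between the four steps at v. *)
have := degE v; rewrite cnt eqxx (negPf vq1) (negPf vq2) !add0n.
rewrite (@deg_mem _ _ ([:: e1; f1] ++ [:: e2; f2])); last 3 first.
- rewrite cat_uniq; apply/and3P; split; [by rewrite /= inE n1| |by rewrite /= inE n2].
  apply/hasPn => h h2.
  by apply/negP => h1; have := disj h (in1 h h1); rewrite in2.
- move=> h; rewrite mem_cat => /orP[] hh; first by rewrite v1 ?in1.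
  by rewrite v2 ?in2.
- move=> h /EW; rewrite !mem_cat => /orP[/v1 ->|/v2 ->] ->; by rewrite ?orbT.
rewrite /= !big_cons big_nil addn0 => d2.
rewrite s1 s2 /= cat_path sep1 last_rcons /= sep2 andbT /separates.
move: d2 ef1 ef2; rewrite !mem_count.
exact: two_loops_mult.
Qed.
(** The walk runs twice through the path from v to w, in opposite directions.
    By odd_loop the first cycle uses both its edges at v or none, so the first
    edge of the path has multiplicity 0 or 2, and so have all its edges. *)
Lemma no_induced_dumbbell v w q q1 q2 :
  path (adj G) v (rcons q1 v) -> ~~ odd (size q1) -> 1 < size q1 ->
  path (adj G) v (rcons q w) ->
  path (adj G) w (rcons q2 w) -> ~~ odd (size q2) -> 1 < size q2 ->
  uniq (q1 ++ v :: q ++ w :: q2) ->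
  ~ {in edges G, forall e, {subset e <= q1 ++ v :: q ++ w :: q2} ->
       e \in steps v (rcons q1 v) ++ steps v (rcons q w) ++ steps w (rcons q2 w)}.
Proof.
move=> p1 ev1 sz1 pq p2 ev2 sz2 uniq_all H.
(* Around the first cycle, along the path, around the second cycle, and back. *)
pose r := rcons q1 v ++ rcons q w ++ rcons q2 w ++ rev (v :: q).
have steps_r : steps v r = steps v (rcons q1 v) ++ steps v (rcons q w)
    ++ steps w (rcons q2 w) ++ rev (steps v (rcons q w)).
  rewrite /r !steps_cat !last_rcons; do 3!congr (_ ++ _).
  by rewrite -(belast_rcons v q w) -{1}(last_rcons v q w) rev_steps.
apply: (koszul_alternating koszulG (x := v) (p := r)).
- rewrite !cat_path !last_rcons p1 pq p2 /=.
  rewrite -(belast_rcons v q w) -{1}(last_rcons v q w) rev_path.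
  by rewrite (eq_path (e' := adj G)) // => x y; rewrite adjC.
- by rewrite !last_cat rev_cons !last_rcons.
- rewrite !size_cat !size_rcons size_rev /= !oddD /= (negPf ev1) (negPf ev2).
  by case: (odd (size q)).
- by rewrite !size_cat !size_rcons; lia.
move=> E EG degE; rewrite steps_r.
have [uq1 uq uq2] : [/\ uniq q1, uniq q & uniq q2].
  by move: uniq_all; rewrite !(cat_uniq, cons_uniq) => /and5P[-> _ _ -> /and3P[_ _ ->]].
have U u : (u \in q1) + (u == v) + (u \in q) + (u == w) + (u \in q2) <= 1.
  have := leq_b1 (u \in q1 ++ v :: q ++ w :: q2).
  rewrite -(count_uniq_mem _ uniq_all) count_cat /= count_cat /= ![_ == u]eq_sym.
  rewrite (count_uniq_mem _ uq1) (count_uniq_mem _ uq) (count_uniq_mem _ uq2).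
  by rewrite !addnA.
have cnt u : count_mem u r
    = (u \in q1) + (u \in q2) + ((u == v) + (u \in q) + (u == w)).*2.
  rewrite /r !count_cat count_rev -!cats1 !count_cat /=.
  rewrite ![_ == u]eq_sym.
  rewrite (count_uniq_mem _ uq1) (count_uniq_mem _ uq) (count_uniq_mem _ uq2).
  by rewrite !addn0; move: (nat_of_bool _) (nat_of_bool _) (nat_of_bool _)
    (nat_of_bool _) (nat_of_bool _); clear; lia.
have EW : {subset E <= steps v (rcons q1 v) ++ steps v (rcons q w)
    ++ steps w (rcons q2 w)}.
  move=> e eE; apply: H; first exact: EG.
  move=> u ue; have : 0 < deg E u by rewrite deg_gt0; apply/hasP; exists e.
  rewrite degE cnt !(mem_cat, inE).
  by case: (u \in q1) (u == v) (u \in q) (u == w) (u \in q2) => [] [] [] [] [].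
split=> [e /EW|]; first by rewrite !mem_cat => /or3P[] ->; rewrite ?orbT.
have st1 e u : e \in steps v (rcons q1 v) -> u \in e -> (u == v) || (u \in q1).
  by move=> es /(mem_steps es); rewrite inE mem_rcons inE orbA orbb.
have stq e u : e \in steps v (rcons q w) -> u \in e ->
    [|| u == v, u == w | u \in q].
  by move=> es /(mem_steps es); rewrite inE mem_rcons inE.
have st2 e u : e \in steps w (rcons q2 w) -> u \in e -> (u == w) || (u \in q2).
  by move=> es /(mem_steps es); rewrite inE mem_rcons inE orbA orbb.
have vw : v == w = false by have := U v; rewrite eqxx; decide_mem.
have Uv : (v \in q1) + (v \in q) + (v \in q2) = 0.
  by have := U v; rewrite eqxx; decide_mem.
have Uw : (w \in q1) + (w \in q) + (w \in q2) = 0.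
  by have := U w; rewrite eqxx; decide_mem.
have [|||||e1 [f1 [l1 [s1 n1 sep1 ef1 v1]]]] := @odd_loop n E v q1.
- by rewrite /= uq1 andbT; move: Uv; case: (v \in q1).
- by [].
- by [].
- by move=> u u1; have := U u; rewrite degE cnt u1; decide_mem.
- move=> e eE u u1 ue; have := EW e eE; rewrite !mem_cat => /or3P[//|es|es].
    by have := stq e u es ue; have := U u; rewrite u1; decide_mem.
  by have := st2 e u es ue; have := U u; rewrite u1; decide_mem.
have [|||||e2 [f2 [l2 [s2 n2 sep2 ef2 v2]]]] := @odd_loop n E w q2.
- by rewrite /= uq2 andbT; move: Uw; case: (w \in q2); rewrite ?addn1.
- by [].
- by [].
- by move=> u u2; have := U u; rewrite degE cnt u2; decide_mem.
- move=> e eE u u2 ue; have := EW e eE; rewrite !mem_cat => /or3P[es|es|//].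
    by have := st1 e u es ue; have := U u; rewrite u2; decide_mem.
  by have := stq e u es ue; have := U u; rewrite u2; decide_mem.
have balq : sorted (fun e f => count_mem e E + count_mem f E == 2)
    (steps v (rcons q w)).
  apply: balanced_steps.
  - by rewrite /= uq andbT; move: Uv; case: (v \in q); rewrite ?addn1.
  - by move: Uw; case: (w \in q); rewrite ?addn1.
  - by rewrite vw.
  - by move=> u uq0; have := U u; rewrite degE cnt uq0; decide_mem.
  move=> e eE u uq0 ue; have := EW e eE; rewrite !mem_cat => /or3P[es|//|es].
    by have := st1 e u es ue; have := U u; rewrite uq0; decide_mem.
  by have := st2 e u es ue; have := U u; rewrite uq0; decide_mem.
have single e u : e \in edges G -> ~ {in e, forall u', u' == u}.
  move=> /edge_pair[a [b [-> ab]]] ub; move: ab.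
  have /eqP -> : a == u by apply: ub; rewrite !inE eqxx.
  have /eqP -> : b == u by apply: ub; rewrite !inE eqxx orbT.
  by rewrite eqxx.
have d1q h : h \in steps v (rcons q1 v) -> h \notin steps v (rcons q w).
  move=> h1; apply/negP => hq; apply: (single h v (steps_edges p1 h1)) => u uh.
  by have := st1 h u h1 uh; have := stq h u hq uh; have := U u; decide_mem.
have d2q h : h \in steps w (rcons q2 w) -> h \notin steps v (rcons q w).
  move=> h2; apply/negP => hq; apply: (single h w (steps_edges p2 h2)) => u uh.
  by have := st2 h u h2 uh; have := stq h u hq uh; have := U u; decide_mem.
have in1 h : h \in [:: e1; f1] -> h \in steps v (rcons q1 v).
  by rewrite s1 !inE mem_rcons inE => /orP[] ->; rewrite ?orbT.
have in2 h : h \in [:: e2; f2] -> h \in steps w (rcons q2 w).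
  by rewrite s2 !inE mem_rcons inE => /orP[] ->; rewrite ?orbT.
have vqw : v \notin rcons q w.
  by rewrite mem_rcons inE vw; move: Uv; case: (v \in q); rewrite ?addn1.
have wvq : w \notin v :: q.
  by rewrite inE eq_sym vw; move: Uw; case: (w \in q); rewrite ?addn1.
have [g [m [sq gv lw]]] : exists g m, [/\ steps v (rcons q w) = g :: m,
    {in steps v (rcons q w), forall e : {set 'I_n}, (v \in e) = (e == g)}
  & {in steps v (rcons q w), forall e : {set 'I_n}, (w \in e) = (e == last g m)}].
  have [y [t qE]] : exists y t, rcons q w = y :: t.
    by case: (q) => [|y t]; [exists w, [::] | exists y, (rcons t w)].
  exists [set v; y], (steps y t); rewrite qE; split=> // e es.
    apply/idP/eqP => [|->]; last by rewrite !inE eqxx.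
    by apply: (steps_head _ es); rewrite -qE.
  have -> : last [set v; y] (steps y t) = [set last v q; w].
    transitivity (last set0 (steps v (rcons q w))); first by rewrite qE.
    by rewrite steps_rcons last_rcons.
  apply/idP/eqP => [|->]; last by rewrite !inE eqxx orbT.
  by move: es; rewrite -qE => es; exact: steps_last.
have gq : g \in steps v (rcons q w) by rewrite sq mem_head.
have lq : last g m \in steps v (rcons q w) by rewrite sq mem_last.
(* At v: the path starts with multiplicity 0 or 2, opposite to the loop. *)
have := degE v; rewrite cnt (_ : _ + _ = 2); last by rewrite eqxx vw; move: Uv; decide_mem.
rewrite (@deg_mem _ _ (g :: [:: e1; f1])); last 3 first.
- rewrite cons_uniq andbC /= inE n1 /=; apply/negP => g1.
  by have := d1q g (in1 g g1); rewrite gq.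
- move=> h; rewrite inE => /predU1P[->|hh]; first by rewrite gv.
  by rewrite v1 ?in1.
- move=> h /EW; rewrite !mem_cat inE => /or3P[hs|hs|hs].
  + by rewrite (v1 _ hs) => ->; rewrite orbT.
  + by rewrite (gv _ hs) => ->.
  + by move/(st2 _ _ hs); rewrite vw => /= v2'; move: Uv; rewrite v2' addn1.
rewrite !big_cons big_nil addn0 => dv.
(* At w: the second loop is opposite to the end of the path. *)
have := degE w; rewrite cnt (_ : _ + _ = 2); last by rewrite eqxx eq_sym vw; move: Uw; decide_mem.
rewrite (@deg_mem _ _ (last g m :: [:: e2; f2])); last 3 first.
- rewrite cons_uniq andbC /= inE n2 /=; apply/negP => g2.
  by have := d2q _ (in2 _ g2); rewrite lq.
- move=> h; rewrite inE => /predU1P[->|hh]; first by rewrite lw.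
  by rewrite v2 ?in2.
- move=> h /EW; rewrite !mem_cat inE => /or3P[hs|hs|hs].
  + move/(st1 _ _ hs); rewrite eq_sym vw => /= w1; move: Uw.
    by rewrite w1 -addnA add1n.
  + by rewrite (lw _ hs) => ->.
  + by rewrite (v2 _ hs) => ->; rewrite orbT.
rewrite !big_cons big_nil addn0 => dw.
move: ef1 ef2; rewrite !mem_count => ef1 ef2.
have [g1 sep_fg] := loop_path_mult dv ef1; have [_ sep_fl] := loop_path_mult dw ef2.
rewrite sq in balq; have [sepq _] := balanced2_separates g1 balq.
have revE : rev (g :: m) = last g m :: rev (belast g m) by rewrite lastI rev_rcons.
have revq : sorted (separates E) (last g m :: rev (belast g m)).
  rewrite -revE rev_sorted /= (eq_path (e' := separates E)) // => e f.
  exact: separates_sym.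
rewrite s1 s2 sq revE /= !cat_path sep1 last_rcons /=.
rewrite !mem_count sep_fg cat_path sepq /= cat_path sep2 last_rcons /=.
rewrite !mem_count sep_fl /=; apply/andP; split; last exact: revq.
by rewrite -ef2 eq_sym.
Qed.
End TwoOddCycles.

(** * Cycles, chords and perfect matchings *)

Section CycleSteps.
Variables (n : nat) (G : sgraph n).
Implicit Types (x y z v : 'I_n) (c p q : seq 'I_n) (e f h : {set 'I_n}).

Lemma fpath_steps (f : 'I_n -> 'I_n) x p :
  fpath f x p -> steps x p = [seq [set y; f y] | y <- belast x p].
Proof. by elim: p x => //= y p IHp x /andP[/eqP <- /IHp ->]. Qed.

Lemma mem_cycle_edges x p e : uniq (x :: p) ->
  (e \in cycle_edges (x :: p)) = (e \in steps x (rcons p x)).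
Proof.
move=> ux; have /fpath_steps -> : fpath (next (x :: p)) x (rcons p x).
  exact: (cycle_next ux).
rewrite belast_rcons; apply/imsetP/mapP => -[y yp ->]; exists y => //.
  by rewrite inE in yp.
by rewrite inE.
Qed.

Lemma is_cycle_cons x p : is_cycle G (x :: p)
  = [&& 1 < size p, path (adj G) x (rcons p x) & uniq (x :: p)].
Proof. by []. Qed.

Lemma is_cycle_uniq c : is_cycle G c -> uniq c.
Proof. by case/and3P. Qed.

Lemma is_cycle_rot k c : is_cycle G (rot k c) = is_cycle G c.
Proof. by rewrite /is_cycle /ucycleb size_rot rot_cycle rot_uniq. Qed.

Lemma cycle_edges_rot k c : uniq c -> cycle_edges (rot k c) = cycle_edges c.
Proof.
move=> uc; apply/setP => e.
apply/imsetP/imsetP => -[y yc ->]; exists y; rewrite ?next_rot //;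
  by move: yc; rewrite !inE mem_rot.
Qed.

Lemma chord_rot k c e : uniq c -> chord G (rot k c) e = chord G c e.
Proof.
move=> uc; rewrite /chord cycle_edges_rot //.
by have -> : [set x in rot k c] = [set x in c] by apply/setP => x; rewrite !inE mem_rot.
Qed.

Lemma cycle_path_rot k c x y : uniq c -> x \in c ->
  cycle_path (rot k c) x y = cycle_path c x y.
Proof. by move=> uc xc; rewrite /cycle_path arc_rot. Qed.

Lemma cycle_path_left x y p1 p2 : uniq (x :: p1 ++ y :: p2) ->
  cycle_path (x :: p1 ++ y :: p2) x y = rcons (x :: p1) y.
Proof. by move=> u; rewrite /cycle_path left_arc. Qed.

Lemma minimal_cycle_rot k c : minimal_cycle G c -> minimal_cycle G (rot k c).
Proof.
move=> [cy mi]; split; first by rewrite is_cycle_rot.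
by move=> e; rewrite chord_rot // is_cycle_uniq.
Qed.

Lemma minimal_cycle_edge c e : minimal_cycle G c -> e \in edges G ->
  {subset e <= c} -> e \in cycle_edges c.
Proof.
move=> [_ mi] eG ec; have := mi e; rewrite /chord eG /= => /nandP[|/negPn //].
by case/negP; apply/subsetP => x /ec; rewrite inE.
Qed.

Lemma split_cycle c x y : uniq c -> x \in c -> y \in c -> x != y ->
  exists k p1 p2, [/\ rot k c = x :: p1 ++ y :: p2,
    cycle_path c x y = rcons (x :: p1) y & cycle_path c y x = rcons (y :: p2) x].
Proof.
move=> uc xc yc xy; have [k p1 p2 a1 a2 rc] := rot_to_arc uc xc yc xy.
by exists k, p1, p2; rewrite /cycle_path -a1 -a2.
Qed.

(** On an even cycle the two arcs cut off by a chord have the same parity. *)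
Lemma chord_parity c e : is_cycle G c -> ~~ odd (size c) -> chord G c e ->
  even_chord G c e \/ odd_chord G c e.
Proof.
move=> cy evc ch; have [eG ec _] := and3P ch.
have [x [y [eE xy]]] := edge_pair eG.
have xc : x \in c by have := subsetP ec x; rewrite eE !inE eqxx; apply.
have yc : y \in c by have := subsetP ec y; rewrite eE !inE eqxx orbT; apply.
have [k [p1 [p2 [rc c1 c2]]]] := split_cycle (is_cycle_uniq cy) xc yc xy.
move: evc; rewrite -(size_rot k) rc /= size_cat /= oddD /=.
case o1 : (odd (size p1)); case o2 : (odd (size p2)) => // _; [right|left];
  by split=> //; exists x, y; rewrite c1 c2 !size_rcons /= o1 o2.
Qed.

End CycleSteps.

Section Matchings.
Variables (n : nat) (G : sgraph n) (E : seq {set 'I_n}).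
Hypothesis EG : {subset E <= edges G}.
Implicit Types (x y z v : 'I_n) (c p q s : seq 'I_n) (e f h : {set 'I_n}).

Lemma deg_double e f v : e \in E -> f \in E -> e != f -> v \in e -> v \in f ->
  1 < deg E v.
Proof.
move=> eE fE ef ve vf; have -> : deg E v = size [seq h : {set 'I_n} <- E | v \in h].
  by rewrite size_filter.
have : {subset [:: e; f] <= [seq h : {set 'I_n} <- E | v \in h]}.
  by move=> h; rewrite !inE mem_filter => /orP[] /eqP ->; rewrite ?ve ?vf.
by move/uniq_leq_size => /=; apply; rewrite inE ef.
Qed.

(** The degrees in s add up to an odd number, while an edge with both ends in s
    contributes 2. *)
Lemma odd_cut s : uniq s -> odd (size s) -> {in s, forall v, deg E v = 1} ->
  exists e a b, [/\ e \in E, e = [set a; b], a \in s & b \notin s].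
Proof.
move=> us os d1.
have sumE : \sum_(e <- E) count (mem e) s = size s.
  rewrite -sum1_size -(eq_big_seq _ d1) /deg.
  under eq_bigr => e _ do rewrite -sum1_count big_mkcond.
  rewrite exchange_big /=; apply: eq_bigr => v _.
  by rewrite -sum1_count [RHS]big_mkcond.
have /hasP[e eE] : has (fun e => odd (count (mem e) s)) E.
  apply: contraLR os => /hasPn evE; rewrite -sumE big_seq.
  apply: (big_ind (fun m => ~~ odd m)) => [//|x y|e /evE //].
  by rewrite oddD => /negPf -> /negPf ->.
have [a [b [eAB ab]]] := edge_pair (EG eE).
have -> : count (mem e) s = (a \in s) + (b \in s).
  have -> : count (mem e) s = count (predU (pred1 a) (pred1 b)) s.
    by apply: eq_count => v; rewrite /= eAB !inE.
  have := count_predUI (pred1 a) (pred1 b) s.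
  rewrite (@eq_count _ (predI _ _) pred0) => [|v /=].
    by rewrite count_pred0 addn0 => ->; rewrite !count_uniq_mem.
  by case: eqP => // ->; exact: negPf.
case sa : (a \in s); case sb : (b \in s) => // _.
  by exists e, a, b; split=> //; rewrite sb.
by exists e, b, a; split=> //; rewrite ?sa // eAB setUC.
Qed.

Section PerfectMatching.
Variable c : seq 'I_n.
Hypothesis cyc : is_cycle G c.
Hypothesis degE : forall v, deg E v = count_mem v c.

Lemma matching_deg v : v \in c -> deg E v = 1.
Proof. by move=> vc; rewrite degE (count_uniq_mem _ (is_cycle_uniq cyc)) vc. Qed.

Lemma matching_sub e : e \in E -> {subset e <= c}.
Proof.
move=> eE v ve; have : 0 < deg E v by rewrite deg_gt0; apply/hasP; exists e.
by rewrite degE -has_count has_pred1.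
Qed.

Lemma matching_inj e f v : e \in E -> f \in E -> v \in e -> v \in f -> e = f.
Proof.
move=> eE fE ve vf; apply/eqP; apply: contraT => ef.
have := deg_double eE fE ef ve vf.
by rewrite matching_deg ?ltnn //; exact: matching_sub ve.
Qed.

Lemma matching_chord e : e \in E -> e \notin cycle_edges c -> chord G c e.
Proof.
move=> eE ec; rewrite /chord (EG eE) ec andbT /=; apply/subsetP => v ve.
by rewrite inE; exact: matching_sub ve.
Qed.

(** The chord cuts off an odd number of vertices on either side, so one of them
    is matched with a vertex of the other side. *)
Lemma odd_chord_crossed e : e \in E -> odd_chord G c e ->
  exists f, [/\ f \in E, chord G c f & cross c e f].
Proof.
move=> eE [ch [i [j [eij oij oji]]]]; have uc := is_cycle_uniq cyc.
have [ie je] : i \in e /\ j \in e by rewrite eij !inE !eqxx orbT.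
have ij : i != j by apply: (@adj_neq _ G); rewrite /adj -eij; exact: EG.
have [k [p1 [p2 [rc c1 c2]]]] :=
  split_cycle uc (matching_sub eE ie) (matching_sub eE je) ij.
have := uc; rewrite -(rot_uniq k) rc => urc.
have := urc; rewrite /= cat_uniq mem_cat negb_or /= => /and5P[/andP[ip1 ip2] up1].
move=> /norP[jp1 /hasPn p21] jp2 up2.
have p1c : {subset p1 <= c}.
  by move=> v vp; rewrite -(mem_rot k) rc inE mem_cat vp orbT.
have [f [a [b [fE fab ap1 bp1]]]] : exists e a b,
    [/\ e \in E, e = [set a; b], a \in p1 & b \notin p1].
  apply: odd_cut => // [|v /p1c/matching_deg //].
  by move: oij; rewrite c1 size_rcons /= negbK.
have [af bf] : a \in f /\ b \in f by rewrite fab !inE !eqxx orbT.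
have ef : e != f.
  apply/eqP => ef; move: af; rewrite -ef eij !inE => /orP[] /eqP ai.
    by rewrite -ai ap1 in ip1.
  by rewrite -ai ap1 in jp1.
have nf v : v \in e -> v \notin f.
  by move=> ve; apply: contra ef => vf; apply/eqP/(matching_inj eE fE ve vf).
have bi : b != i by apply: contraTneq bf => ->; exact: nf.
have bj : b != j by apply: contraTneq bf => ->; exact: nf.
have bp2 : b \in p2.
  have := matching_sub fE bf.
  by rewrite -(mem_rot k) rc inE mem_cat inE (negPf bi) (negPf bj) (negPf bp1).
exists f; split=> //.
  apply: matching_chord => //; rewrite -(cycle_edges_rot k uc) rc.
  rewrite mem_cycle_edges // rcons_cat /= -cat_rcons steps_cat last_rcons.
  rewrite mem_cat negb_or; apply/andP; split; apply/negP => fs.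
    have := mem_steps fs bf; rewrite inE mem_rcons inE.
    by rewrite (negPf bi) (negPf bj) (negPf bp1).
  have := mem_steps fs af; rewrite inE mem_rcons inE => /or3P[/eqP|/eqP|] aE.
  - by rewrite -aE ap1 in jp1.
  - by rewrite -aE ap1 in ip1.
  - by have := p21 a aE; rewrite /= ap1.
split.
  rewrite -setI_eq0; apply/eqP/setP => v; rewrite !inE.
  by apply/negP => /andP[/nf/negPf ->].
exists i, j, a, b; split=> //; first by rewrite c1 mem_rcons !inE ap1 !orbT.
by rewrite c2 mem_rcons !inE bp2 !orbT.
Qed.
End PerfectMatching.

End Matchings.

(** * Even cycles *)

Section EvenCycles.
Variables (K : fieldType) (n : nat) (G : sgraph n).
Implicit Types (x y z v : 'I_n) (c p q : seq 'I_n) (e f h : {set 'I_n}).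
Implicit Types E : seq {set 'I_n}.
Hypothesis koszulG : Koszul (@rees_gen K n G).

(** For a cycle c: the perfect matchings of the subgraph induced on c. *)
Definition matching E c :=
  {subset E <= edges G} /\ forall v, deg E v = count_mem v c.

Lemma count_rcons_cycle x p v : count_mem v (rcons p x) = count_mem v (x :: p).
Proof. by rewrite -cats1 count_cat /= addn0 addnC. Qed.

Lemma matching_separates E x p : is_cycle G (x :: p) -> matching E (x :: p) ->
  {subset E <= steps x (rcons p x)} -> sorted (separates E) (steps x (rcons p x)).
Proof.
move=> cyc [EG degE] EW; have ux := is_cycle_uniq cyc.
apply/balanced1_separates/balanced_steps => //.
- by case/andP: ux.
- by case/and3P: cyc => [sz _ _]; rewrite orbC -ltnS sz.
- by move=> y yp; apply: (matching_deg cyc degE); rewrite inE yp orbT.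
- by move=> e /EW eW y _ _.
Qed.

(** Otherwise no perfect matching uses a chord, since an odd chord would come
    with another one that crosses it. *)
Lemma even_cycle_chord c : is_cycle G c -> ~~ odd (size c) -> 6 <= size c ->
  (forall e, ~ even_chord G c e) ->
  exists e f, [/\ odd_chord G c e, odd_chord G c f & cross c e f].
Proof.
move=> cyc evc szc noeven; apply: contrapT => nocross.
have noc E e : matching E c -> e \in E -> e \in cycle_edges c.
  move=> [EG degE] eE; apply: contraT => ec.
  have ch := matching_chord EG degE eE ec.
  case: (chord_parity cyc evc ch) => [/noeven //|oc].
  have [f [fE chf cr]] := odd_chord_crossed EG cyc degE eE oc.
  case: (chord_parity cyc evc chf) => [/noeven //|odf].
  by case: nocross; exists e, f.
case: c cyc evc szc {noeven nocross} noc => // x p cyc evc szc noc.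
have /and3P[_ pp ux] := cyc.
apply: (koszul_alternating koszulG (x := x) (p := rcons p x)) => //.
- by rewrite last_rcons.
- by rewrite size_rcons.
- by rewrite size_rcons.
move=> E EG degE; have mE : matching E (x :: p).
  by split=> // v; rewrite degE count_rcons_cycle.
have EW : {subset E <= steps x (rcons p x)}.
  by move=> e /(noc _ _ mE); rewrite mem_cycle_edges.
by split=> //; exact: matching_separates.
Qed.

Lemma chord_mem c e : chord G c e -> {subset e <= c}.
Proof. by case/and3P=> _ /subsetP ec _ v /ec; rewrite inE. Qed.

(** Each of the two chords has to be crossed by a chord of the matching. *)
Lemma crossing_pair_together c e f E : is_cycle G c -> matching E c ->
  odd_chord G c e -> odd_chord G c f ->
  (forall h, chord G c h -> h = e \/ h = f) -> (e \in E) = (f \in E).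
Proof.
move=> cyc [EG degE] oe of_ only.
have self h h' : cross c h h' -> chord G c h -> h <> h'.
  move=> [+ _] /and3P[/card_edge h2 _ _] hh; rewrite -hh -setI_eq0 setIid => /eqP h0.
  by rewrite h0 cards0 in h2.
apply/idP/idP => inE_.
  have [h [hE ch cr]] := odd_chord_crossed EG cyc degE inE_ oe.
  by case: (only h ch) => hh; [case: (self _ _ cr oe.1) | rewrite -hh].
have [h [hE ch cr]] := odd_chord_crossed EG cyc degE inE_ of_.
by case: (only h ch) => hh; [rewrite -hh | case: (self _ _ cr of_.1)].
Qed.

(** If the first step is not in E, neither are the third, the fifth, and so on. *)
Lemma unmatched_alternate E x s z : uniq (x :: s) -> z \notin s -> x != z ->
  {in s, forall y, deg E y = 1} ->
  {in E, forall e, {in s, forall y, y \in e -> e \in steps x (rcons s z)}} ->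
  (forall e, e \in E -> e \in steps x (rcons s z) -> x \notin e) ->
  {in alternate true (steps x (rcons s z)), forall e, e \notin E}.
Proof.
move=> us zs xz d1 Es xE; have xz' : (x != z) || (1 < size s) by rewrite xz.
have := balanced1_separates (balanced_steps us zs xz' d1 Es).
case/alternate_sorted=> b [bt _] e et; rewrite bt //.
have : exists2 h : {set 'I_n}, h \in alternate true (steps x (rcons s z)) & x \in h.
  by case: (s) => [|y s']; [exists [set x; z] | exists [set x; y]];
    rewrite ?mem_head // !inE eqxx.
case=> h ht xh; rewrite -(bt h ht); apply/negP => hE.
by have := xE h hE; rewrite mem_alternate ht xh => /(_ isT).
Qed.

(** A matching that contains both chords takes the remaining vertices by the
    matching of C that contains the edges x1 x2 and x3 x4.  Hence that matching
    together with the two chords is one side of the fibre. *)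
Lemma ladder_obstruction x1 x2 s2 x3 x4 s4
    (c := x1 :: x2 :: s2 ++ x3 :: x4 :: s4) :
  is_cycle G c -> ~~ odd (size s2) -> ~~ odd (size s4) -> 6 <= size c ->
  odd_chord G c [set x1; x3] -> odd_chord G c [set x2; x4] ->
  ~ (forall h, chord G c h -> h = [set x1; x3] \/ h = [set x2; x4]).
Proof.
move=> cyc ev2 ev4 szc och1 och2 only.
set e := [set x1; x3] in och1 only; set f := [set x2; x4] in och2 only.
have uc := is_cycle_uniq cyc.
pose p := x2 :: s2 ++ x3 :: x4 :: s4.
pose M2 := steps x2 (rcons s2 x3); pose M4 := steps x4 (rcons s4 x1).
have WE : steps x1 (rcons p x1) = [set x1; x2] :: M2 ++ [set x3; x4] :: M4.
  by rewrite /p /= rcons_cat -cat_rcons steps_cat last_rcons.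
have U u : (u == x1) + (u == x2) + (u \in s2) + (u == x3) + (u == x4)
    + (u \in s4) <= 1.
  have := leq_b1 (u \in c); rewrite -(count_uniq_mem _ uc) /= count_cat /=.
  have [us2 us4] : uniq s2 /\ uniq s4.
    by move: uc; rewrite /= cat_uniq /= => /and5P[_ _ -> _ /and3P[_ _ ->]].
  rewrite (count_uniq_mem _ us2) (count_uniq_mem _ us4) ![_ == u]eq_sym.
  by rewrite !addnA.
have cE h : (h \in cycle_edges c) = (h \in steps x1 (rcons p x1)).
  exact: mem_cycle_edges.
have altE E : matching E c -> e \notin E ->
    {subset E <= steps x1 (rcons p x1)}
    /\ sorted (separates E) (steps x1 (rcons p x1)).
  move=> mE eE; have fE : f \notin E.
    by rewrite -(crossing_pair_together cyc mE och1 och2 only).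
  have EW : {subset E <= steps x1 (rcons p x1)}.
    move=> h hE; rewrite -cE; apply: contraT => hc.
    have /only[hh|hh] := matching_chord mE.1 mE.2 hE hc.
      by rewrite -hh hE in eE.
    by rewrite -hh hE in fE.
  by split=> //; exact: (matching_separates (cyc : is_cycle G (x1 :: p)) mE EW).
(* One side of the fibre: the matching with x1 x2 and x3 x4, and both chords. *)
pose P h := (h \in alternate true (steps x1 (rcons p x1))) || (h \in [:: e; f]).
have pp : path (adj G) x1 (rcons p x1) by have /and3P[] := cyc.
have chordW h : chord G c h -> h \notin steps x1 (rcons p x1).
  by case/and3P=> _ _; rewrite -cE.
have eW := chordW _ och1.1; have fW := chordW _ och2.1.
have noPf : all (predC P) (alternate false (steps x1 (rcons p x1))).
  have evp : ~~ odd (size (rcons p x1)).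
    by rewrite size_rcons /= size_cat /= oddD /= (negPf ev2) (negPf ev4).
  pose E0 := alternate true (steps x1 (rcons p x1)).
  have E0W : {subset E0 <= steps x1 (rcons p x1)}.
    by move=> h h0; rewrite mem_alternate h0.
  have mE0 : matching E0 c.
    split=> [h /E0W hW|v]; first exact: (steps_edges pp hW).
    rewrite -(count_rcons_cycle x1 p).
    exact: (deg_alternate_closed true v pp (last_rcons _ _ _) evp).
  have [_ /alternate_sorted[b [bt bf]]] := altE E0 mE0 (contra (E0W e) eW).
  have b1 : b = true by rewrite -(bt [set x1; x2]) ?WE //= ?mem_head // /E0 WE mem_head.
  apply/allP => h hf; have hW : h \in steps x1 (rcons p x1).
    by rewrite mem_alternate hf orbT.
  have /= := bf h hf; rewrite b1 /P => /negbT; rewrite /E0 => /negPf -> /=.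
  by rewrite !inE negb_or; apply/andP; split; apply/eqP => hh;
    [rewrite -hh hW in eW | rewrite -hh hW in fW].
apply: (negP (koszul_walk koszulG (P := P) pp _ _ _ _ _)) noPf.
- by rewrite last_rcons.
- by rewrite size_rcons /= size_cat /= oddD /= (negPf ev2) (negPf ev4).
- by rewrite size_rcons.
- move=> E EG degE; have mE : matching E c.
    by split=> // v; rewrite degE count_rcons_cycle.
  have [eE|eE] := boolP (e \in E); last first.
    have [EW /alternate_sorted[b [bt bf]]] := altE E mE eE.
    have fE : f \notin E.
      by rewrite -(crossing_pair_together cyc mE och1 och2 only).
    case: b bt bf => bt bf; [left|right]; apply/allP => h hE.
      have := EW h hE; rewrite /P mem_alternate => /orP[-> //|/bf].
      by rewrite hE.
    rewrite /= /P negb_or; apply/andP; split.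
      by apply/negP => /bt; rewrite hE.
    by rewrite !inE negb_or; apply/andP; split; apply/eqP => hh;
      [rewrite -hh hE in eE | rewrite -hh hE in fE].
  left; have fE : f \in E.
    by rewrite -(crossing_pair_together cyc mE och1 och2 only).
  have EW h : h \in E -> [\/ h \in steps x1 (rcons p x1), h = e | h = f].
    move=> hE; have [hc|hc] := boolP (h \in cycle_edges c).
      by constructor 1; rewrite -cE.
    by have /only[->|->] := matching_chord EG mE.2 hE hc; [constructor 2 | constructor 3].
  have d1 := matching_deg cyc mE.2.
  have no2 : {in alternate true M2, forall h, h \notin E}.
    apply: unmatched_alternate.
    - move: uc (U x2); rewrite /= cat_uniq /= => /and5P[_ _ -> _ _].
      by rewrite eqxx andbT; decide_mem.
    - by have := U x3; rewrite eqxx; decide_mem.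
    - by have := U x3; rewrite eqxx [x2 == x3]eq_sym; decide_mem.
    - by move=> y ys; apply: d1; rewrite !inE mem_cat ys !orbT.
    - move=> h /EW[hW|->|->] y ys yh; last 2 first.
      + by move: yh (U y); rewrite !inE ys; decide_mem.
      + by move: yh (U y); rewrite !inE ys; decide_mem.
      move: hW; rewrite WE !(inE, mem_cat) => /or4P[/eqP hh|//|/eqP hh|hM4].
      + by move: yh (U y); rewrite hh !inE ys; decide_mem.
      + by move: yh (U y); rewrite hh !inE ys; decide_mem.
      + by have := U y; have := mem_steps hM4 yh; rewrite inE mem_rcons inE ys; decide_mem.
    - move=> h hE hM; apply/negP => xh; have x2f : x2 \in f by rewrite !inE eqxx.
      have hf := matching_inj cyc mE.2 hE fE xh x2f.
      by case/negP: fW; rewrite -hf WE inE mem_cat hM orbT.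
  have no4 : {in alternate true M4, forall h, h \notin E}.
    apply: unmatched_alternate.
    - move: uc (U x4); rewrite /= cat_uniq /= => /and5P[_ _ _ _ /and3P[_ _ ->]].
      by rewrite eqxx andbT; decide_mem.
    - by have := U x1; rewrite eqxx; decide_mem.
    - by have := U x1; rewrite eqxx [x4 == x1]eq_sym; decide_mem.
    - by move=> y ys; apply: d1; rewrite !(inE, mem_cat) ys !orbT.
    - move=> h /EW[hW|->|->] y ys yh; last 2 first.
      + by move: yh (U y); rewrite !inE ys; decide_mem.
      + by move: yh (U y); rewrite !inE ys; decide_mem.
      move: hW; rewrite WE !(inE, mem_cat) => /or4P[/eqP hh|hM2|/eqP hh|//].
      + by move: yh (U y); rewrite hh !inE ys; decide_mem.
      + by have := U y; have := mem_steps hM2 yh; rewrite inE mem_rcons inE ys; decide_mem.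
      + by move: yh (U y); rewrite hh !inE ys; decide_mem.
    - move=> h hE hM; apply/negP => xh; have x4f : x4 \in f by rewrite !inE eqxx orbT.
      have hf := matching_inj cyc mE.2 hE fE xh x4f.
      by case/negP: fW; rewrite -hf WE !(inE, mem_cat) hM !orbT.
  have noF h : h \in alternate false (steps x1 (rcons p x1)) -> h \notin E.
    rewrite WE [alternate _ _]/= alternate_cat size_steps size_rcons /= ev2 mem_cat.
    by case/orP=> [/no2|/no4].
  apply/allP => h hE; rewrite /P; case: (EW h hE) => [hW|->|->].
  - move: hW; rewrite mem_alternate => /orP[-> //|/noF].
    by rewrite hE.
  - by rewrite mem_head orbT.
  - by rewrite !inE eqxx !orbT.
- by apply/allP => h; rewrite /P /= => ->.
Qed.

Lemma set2_eq x y i j : [set x; y] = [set i; j] ->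
  (i = x /\ j = y) \/ (i = y /\ j = x).
Proof.
move=> xy; have : x \in [set i; j] by rewrite -xy !inE eqxx.
rewrite !inE => /orP[] /eqP xE; [left|right]; subst x; split=> //.
  exact/esym/(set2_inj xy).
by apply/esym; move: xy; rewrite [RHS]setUC => /set2_inj.
Qed.

Lemma odd_chord_path c x y :
  odd_chord G c [set x; y] -> odd (size (cycle_path c x y)).
Proof. by move=> [_ [i [j [/set2_eq[] [-> ->] ? ?]]]]. Qed.

Lemma even_chord_path c x y :
  even_chord G c [set x; y] -> ~~ odd (size (cycle_path c x y)).
Proof. by move=> [_ [i [j [/set2_eq[] [-> ->] ? ?]]]]. Qed.

Lemma odd_chord_rot k c e : uniq c -> odd_chord G c e -> odd_chord G (rot k c) e.
Proof.
move=> uc [ch [i [j [eij oij oji]]]]; split; first by rewrite chord_rot.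
exists i, j; rewrite !cycle_path_rot //; apply: (chord_mem ch);
  by rewrite eij !inE eqxx ?orbT.
Qed.

(** A matching with both chords would have to match the odd number of vertices of
    s1 among themselves. *)
Lemma odd_arcs_obstruction x1 s1 x2 s2 x3 s3 x4 s4
    (c := x1 :: s1 ++ x2 :: s2 ++ x3 :: s3 ++ x4 :: s4) :
  is_cycle G c -> ~~ odd (size c) -> 6 <= size c -> odd (size s1) ->
  odd_chord G c [set x1; x3] -> odd_chord G c [set x2; x4] ->
  ~ (forall h, chord G c h -> h = [set x1; x3] \/ h = [set x2; x4]).
Proof.
move=> cyc evc szc odd1 och1 och2 only.
set e := [set x1; x3] in och1 only; set f := [set x2; x4] in och2 only.
have uc := is_cycle_uniq cyc.
pose p := s1 ++ x2 :: s2 ++ x3 :: s3 ++ x4 :: s4.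
have WE : steps x1 (rcons p x1) = steps x1 (rcons s1 x2)
    ++ steps x2 (rcons (s2 ++ x3 :: s3 ++ x4 :: s4) x1).
  by rewrite /p /= rcons_cat /= -cat_rcons steps_cat last_rcons.
have s1P a : a \in s1 -> a \notin x2 :: rcons (s2 ++ x3 :: s3 ++ x4 :: s4) x1
    /\ [/\ a != x1, a != x2, a != x3 & a != x4].
  move=> as1; have [ax1 aR] : a != x1
      /\ a \notin x2 :: s2 ++ x3 :: s3 ++ x4 :: s4.
    move: uc; rewrite /= cat_uniq mem_cat negb_or.
    move=> /and4P[/andP[x1s1 _] _ /hasPn sR _]; split.
      by apply: contraNneq x1s1 => <-.
    by apply/negP => /sR; rewrite /= as1.
  move: aR; rewrite !(inE, mem_cat, mem_rcons) (negPf ax1) /=.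
  by decide_mem.
have us1 : uniq s1 by move: uc; rewrite /= cat_uniq => /and3P[].
apply: (koszul_alternating koszulG (x := x1) (p := rcons p x1)).
- by have /and3P[] := cyc.
- by rewrite last_rcons.
- by rewrite size_rcons.
- by rewrite size_rcons.
move=> E EG degE; have mE : matching E c.
  by split=> // v; rewrite degE count_rcons_cycle.
have eE : e \notin E.
  apply/negP => eE; have fE : f \in E.
    by rewrite -(crossing_pair_together cyc mE och1 och2 only).
  have [|h [a [b [hE hab as1 bs1]]]] := odd_cut EG us1 odd1.
    by move=> v vs; apply: (matching_deg cyc mE.2); rewrite inE mem_cat vs orbT.
  have [an [a1 a2 a3 a4]] := s1P a as1.
  have [ah bh] : a \in h /\ b \in h by rewrite hab !inE !eqxx orbT.
  have he : h != e.
    by apply: contraTneq ah => ->; rewrite !inE negb_or a1 a3.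
  have hf : h != f.
    by apply: contraTneq ah => ->; rewrite !inE negb_or a2 a4.
  have hW : h \in steps x1 (rcons p x1).
    rewrite -(mem_cycle_edges _ uc); apply: contraT => hc.
    have /only[/eqP|/eqP] := matching_chord EG mE.2 hE hc;
      by rewrite ?(negPf he) ?(negPf hf).
  move: hW; rewrite WE mem_cat => /orP[] hs; last first.
    by have := mem_steps hs ah; rewrite (negPf an).
  have := mem_steps hs bh; rewrite inE mem_rcons inE (negPf bs1) orbF.
  case/orP=> /eqP bE.
    have x1e : x1 \in e by rewrite !inE eqxx.
    have := matching_inj cyc mE.2 hE eE bh; rewrite bE => /(_ x1e) /eqP.
    by rewrite (negPf he).
  have x2f : x2 \in f by rewrite !inE eqxx.
  have := matching_inj cyc mE.2 hE fE bh; rewrite bE => /(_ x2f) /eqP.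
  by rewrite (negPf hf).
have fE : f \notin E.
  by rewrite -(crossing_pair_together cyc mE och1 och2 only).
have EW : {subset E <= steps x1 (rcons p x1)}.
  move=> h hE; rewrite -(mem_cycle_edges _ uc); apply: contraT => hc.
  have /only[hh|hh] := matching_chord mE.1 mE.2 hE hc.
    by rewrite -hh hE in eE.
  by rewrite -hh hE in fE.
by split=> //; exact: (matching_separates (cyc : is_cycle G (x1 :: p)) mE EW).
Qed.

Lemma steps_interior x q z h : q != [::] -> h \in steps x (rcons q z) ->
  exists2 v, v \in q & v \in h.
Proof.
elim: q x => // y q IHq x _ /=; rewrite inE => /predU1P[->|].
  by exists y; rewrite !inE eqxx ?orbT.
case: q IHq => [_|y' q IHq /IHq[//|v vq vh]].
  by rewrite inE => /eqP ->; exists y; rewrite !inE eqxx.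
by exists v; rewrite // inE vq orbT.
Qed.

(** The chords together with the arcs s2 and s4 form an even cycle of length at
    least 6.  A chord of it is an edge of c, namely x1 x2 with s1 empty or
    x3 x4 with s3 empty.  As s1 and s3 are not both empty there is at most one,
    and it is an odd-chord. *)
Lemma detour_obstruction x1 s1 x2 s2 x3 s3 x4 s4
    (c := x1 :: s1 ++ x2 :: s2 ++ x3 :: s3 ++ x4 :: s4) :
  is_cycle G c -> ~~ odd (size s2) -> ~~ odd (size s4) ->
  (s1 != [::]) || (s3 != [::]) -> (s2 != [::]) || (s4 != [::]) ->
  adj G x1 x3 -> adj G x2 x4 ->
  ~ (forall h, chord G c h -> h = [set x1; x3] \/ h = [set x2; x4]).
Proof.
move=> cyc ev2 ev4 s13 s24 a13 a24 only.
(* The cycle x1 -> x3 -> s2 backwards -> x2 -> x4 -> s4 -> x1. *)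
pose d := x1 :: (x3 :: rev s2) ++ x2 :: x4 :: s4.
have uc := is_cycle_uniq cyc.
pose p := s1 ++ x2 :: s2 ++ x3 :: s3 ++ x4 :: s4.
have pc : path (adj G) x1 (rcons p x1) by have /and3P[] := cyc.
have pE : rcons p x1 = rcons s1 x2 ++ rcons s2 x3 ++ rcons s3 x4 ++ rcons s4 x1.
  by rewrite /p !(rcons_cat, rcons_cons, cat_rcons).
have WE : steps x1 (rcons p x1) = steps x1 (rcons s1 x2)
    ++ steps x2 (rcons s2 x3) ++ steps x3 (rcons s3 x4) ++ steps x4 (rcons s4 x1).
  by rewrite pE !steps_cat !last_rcons.
have rev2 : rev (belast x2 (rcons s2 x3)) = rcons (rev s2) x2.
  by rewrite belast_rcons rev_cons.
have SD : steps x1 (rcons ((x3 :: rev s2) ++ x2 :: x4 :: s4) x1)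
    = [set x1; x3] :: rev (steps x2 (rcons s2 x3)) ++ [set x2; x4]
        :: steps x4 (rcons s4 x1).
  rewrite -rev_steps rev2 last_rcons /= rcons_cat /= -cat_rcons steps_cat.
  by rewrite last_rcons.
have permd : perm_eq d ([:: x1] ++ (x2 :: s2) ++ [:: x3] ++ (x4 :: s4)).
  apply/permP => P; rewrite /d /= !(count_cat, count_rev) /= ?count_cat /=.
  move: (nat_of_bool _) (nat_of_bool _) (nat_of_bool _) (nat_of_bool _).
  by move: (count P s2) (count P s4); clear; lia.
have subd : subseq ([:: x1] ++ (x2 :: s2) ++ [:: x3] ++ (x4 :: s4)) c.
  apply: (@cat_subseq _ [:: x1] _ (x1 :: s1)); first by rewrite sub1seq mem_head.
  apply: (@cat_subseq _ (x2 :: s2) _ (x2 :: s2)) => //.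
  by apply: (@cat_subseq _ [:: x3] _ (x3 :: s3)); rewrite ?sub1seq ?mem_head.
have ud : uniq d by rewrite (perm_uniq permd) (subseq_uniq subd).
have dc v : v \in d -> v \in c by rewrite (perm_mem permd); exact: mem_subseq.
have cycd : is_cycle G d.
  rewrite is_cycle_cons ud andbT; apply/andP; split.
    by rewrite size_cat /= !addnS.
  move: pc; rewrite pE !cat_path !last_rcons => /and4P[_ p2 _ p4].
  rewrite rcons_cat /= a13 -cat_rcons cat_path last_rcons /= a24 p4 !andbT.
  rewrite -rev2 -[X in path _ X](last_rcons x2 s2 x3) rev_path.
  by rewrite (eq_path (e' := adj G)) // => x y; rewrite adjC.
have edged h : (h \in cycle_edges d)
    = [|| h == [set x1; x3], h \in steps x2 (rcons s2 x3), h == [set x2; x4]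
        | h \in steps x4 (rcons s4 x1)].
  by rewrite mem_cycle_edges // SD inE mem_cat mem_rev inE.
have disj v : v \in d -> v \notin s1 ++ s3.
  move=> vd; have := count_uniq_mem v uc; rewrite (dc v vd).
  have : 0 < count_mem v d by rewrite -has_count has_pred1.
  rewrite (permP permd) /= -[v \in _]has_pred1 has_count.
  rewrite !count_cat /= !count_cat /= ?count_cat /=.
  move: (nat_of_bool _) (nat_of_bool _) (nat_of_bool _) (nat_of_bool _).
  by move: (count _ s1) (count _ s2) (count _ s3) (count _ s4); clear; lia.
have chord_d h : chord G d h ->
    (s1 = [::] /\ h = [set x1; x2]) \/ (s3 = [::] /\ h = [set x3; x4]).
  move=> ch; have [hG _ hd] := and3P ch; have hdP := chord_mem ch.
  rewrite edged !negb_or in hd; case/and4P: hd => h13 h2 h24 h4.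
  have hW : h \in steps x1 (rcons p x1).
    rewrite -(mem_cycle_edges _ uc); apply: contraT => hc.
    have chc : chord G c h.
      apply/and3P; split=> //.
      by apply/subsetP => v /hdP vd; rewrite inE; exact: dc.
    by case: (only h chc) => /eqP; rewrite ?(negPf h13) ?(negPf h24).
  move: hW; rewrite WE !mem_cat (negPf h2) (negPf h4) orbF.
  case/orP=> hs; [left|right].
    have [s1E|/steps_interior/(_ hs)[v v1 vh]] := eqVneq s1 [::].
      by move: hs; rewrite s1E inE => /eqP.
    by have := disj v (hdP v vh); rewrite mem_cat v1.
  have [s3E|/steps_interior/(_ hs)[v v3 vh]] := eqVneq s3 [::].
    by move: hs; rewrite s3E inE => /eqP.
  by have := disj v (hdP v vh); rewrite mem_cat v3 orbT.
have evd : ~~ odd (size d).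
  by rewrite /= size_cat /= size_rev oddD /= (negPf ev2) (negPf ev4).
have szd : 6 <= size d.
  rewrite /= size_cat /= size_rev.
  case: (s2) (s4) s24 ev2 ev4 => [|? [|? ?]] [|? [|? ?]] //= _ _ _.
  - by rewrite !addnS addn0.
  - by rewrite !addnS.
have [h evh|h [h' [[ch _] [ch' _] [dis _]]]] := even_cycle_chord cycd evd szd.
  case: (chord_d h evh.1) => -[_ hE]; move: evh; rewrite hE => /even_chord_path.
    by rewrite (cycle_path_left ud) size_rcons /= size_rev (negPf ev2).
  rewrite -(cycle_path_rot 1) ?inE ?eqxx ?orbT //.
  have d1E : rot 1 d = x3 :: (rcons (rev s2) x2) ++ x4 :: rcons s4 x1.
    by rewrite rot1_cons /= rcons_cat /= cat_rcons.
  have := ud; rewrite -(rot_uniq 1) d1E => ud1.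
  by rewrite (cycle_path_left ud1) size_rcons /= size_rcons size_rev /= (negPf ev2).
have hh : h = h'.
  case: (chord_d h ch) (chord_d h' ch') s13 => -[sE ->] [] [sE' ->] //;
    by rewrite sE sE'.
move: dis; rewrite hh -setI_eq0 setIid => /eqP h0.
by case/and3P: ch' => /card_edge; rewrite h0 cards0.
Qed.

(** As both chords are odd, the sizes of the four arcs have the same parity. *)
Lemma two_crossing_chords_obstruction x1 s1 x2 s2 x3 s3 x4 s4
    (c := x1 :: s1 ++ x2 :: s2 ++ x3 :: s3 ++ x4 :: s4) :
  is_cycle G c -> ~~ odd (size c) -> 6 <= size c ->
  odd_chord G c [set x1; x3] -> odd_chord G c [set x2; x4] ->
  ~ (forall h, chord G c h -> h = [set x1; x3] \/ h = [set x2; x4]).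
Proof.
move=> cyc evc szc och1 och2 only; have uc := is_cycle_uniq cyc.
have o12 : ~~ odd (size s1 + size s2).
  have cE : c = x1 :: (s1 ++ x2 :: s2) ++ x3 :: (s3 ++ x4 :: s4) by rewrite -catA.
  have := odd_chord_path och1; rewrite cE in uc *; rewrite (cycle_path_left uc).
  by rewrite size_rcons /= size_cat /= addnS /= !negbK.
have o23 : ~~ odd (size s2 + size s3).
  have rE : rot (size s1).+1 c
      = x2 :: (s2 ++ x3 :: s3) ++ x4 :: (s4 ++ x1 :: s1).
    by rewrite /c -cat_cons (rot_size_cat (x1 :: s1)) /= -!catA /= -!catA.
  have := uc; rewrite -(rot_uniq (size s1).+1) rE => ur.
  have := odd_chord_path (odd_chord_rot (size s1).+1 uc och2).
  rewrite rE (cycle_path_left ur).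
  by rewrite size_rcons /= size_cat /= addnS /= !negbK.
have [ev1|ev1] := boolP (odd (size s1)).
  exact: (odd_arcs_obstruction cyc).
have ev2 : ~~ odd (size s2) by move: o12; rewrite oddD (negPf ev1).
have ev3 : ~~ odd (size s3) by move: o23; rewrite oddD (negPf ev2).
have ev4 : ~~ odd (size s4).
  move: evc; rewrite /= !size_cat /= !size_cat /= !size_cat /=.
  by rewrite !(oddD, oddS) /= (negPf ev1) (negPf ev2) (negPf ev3); case: odd.
have adjE x y : [set x; y] \in edges G -> adj G x y by [].
have [e1 e2] : adj G x1 x3 /\ adj G x2 x4.
  by case: och1 och2 => /and3P[? _ _] _ [/and3P[? _ _] _].
case: (boolP ((s1 != [::]) || (s3 != [::]))) => [s13|]; last first.
  rewrite negb_or !negbK => /andP[/eqP n1 /eqP n3].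
  rewrite /c n1 n3 in cyc szc och1 och2 only.
  exact: (@ladder_obstruction x1 x2 s2 x3 x4 s4).
case: (boolP ((s2 != [::]) || (s4 != [::]))) => [s24|].
  exact: (detour_obstruction cyc ev2 ev4 s13 s24 e1 e2 only).
rewrite negb_or !negbK => /andP[/eqP n2 /eqP n4].
have rE : rot (size s1).+1 c = x2 :: x3 :: s3 ++ x4 :: x1 :: s1.
  by rewrite /c n2 n4 -cat_cons (rot_size_cat (x1 :: s1)) /= -!catA.
apply: (@ladder_obstruction x2 x3 s3 x4 x1 s1) => //; rewrite -rE.
- by rewrite is_cycle_rot.
- by rewrite size_rot.
- exact: odd_chord_rot.
- by rewrite setUC; exact: odd_chord_rot.
- by move=> h; rewrite chord_rot // => /only[->|->]; [right; rewrite setUC | left].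
Qed.

(** Without even chords and with a crossing pair of odd chords, any third chord
    is odd and will do. *)
Lemma even_cycle_condition c :
  is_cycle G c -> ~~ odd (size c) -> 6 <= size c ->
  (exists e, even_chord G c e) \/
  (exists e e' e'',
     [/\ odd_chord G c e, odd_chord G c e' & odd_chord G c e''] /\
     [/\ e != e', e != e'', e' != e'' & cross c e e']).
Proof.
move=> cyc evc szc; apply: contrapT => /not_orP[noev no3].
have noeven e : ~ even_chord G c e by move=> ee; apply: noev; exists e.
have [e [f [oe of_ cr]]] := even_cycle_chord cyc evc szc noeven.
have uc := is_cycle_uniq cyc.
have [dis [i [j [i' [j' [eE fE i'c j'c]]]]]] := cr.
have ie : i \in e /\ j \in e by rewrite eE !inE !eqxx orbT.
have if_ : i' \in f /\ j' \in f by rewrite fE !inE !eqxx orbT.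
have nef v : v \in f -> v \notin e.
  by move=> vf; apply/negP => ve; move/disjointFr: dis => /(_ v ve); rewrite vf.
have only h : chord G c h -> h = e \/ h = f.
  move=> ch; have [->|he] := eqVneq h e; first by left.
  have [->|hf] := eqVneq h f; first by right.
  case: (chord_parity cyc evc ch) => [/noeven //|oh]; case: no3.
  exists e, f, h; split; split=> //; rewrite 1?eq_sym //.
  by apply: contraTneq (nef _ if_.1) => <-; rewrite if_.1.
have [eG ec _] := and3P oe.1; have ij : i != j.
  by apply: (@adj_neq _ G); rewrite /adj -eE.
have [k [p1 [p2 [rc c1 c2]]]] :=
  split_cycle uc (chord_mem oe.1 ie.1) (chord_mem oe.1 ie.2) ij.
have i'p1 : i' \in p1.
  move: i'c (nef _ if_.1); rewrite c1 eE mem_rcons !inE negb_or.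
  by case/or3P=> [->|->|//]; rewrite ?andbF.
have j'p2 : j' \in p2.
  move: j'c (nef _ if_.2); rewrite c2 eE mem_rcons !inE negb_or.
  by case/or3P=> [->|->|//]; rewrite ?andbF.
case/splitPr: i'p1 rc {c1 i'c} => s1 s2; case/splitPr: j'p2 {c2 j'c} => s3 s4.
rewrite -catA /= => rc.
apply: (@two_crossing_chords_obstruction i s1 i' s2 j s3 j' s4); rewrite -rc.
- by rewrite is_cycle_rot.
- by rewrite size_rot.
- by rewrite size_rot.
- by rewrite -eE; exact: odd_chord_rot.
- by rewrite -fE; exact: odd_chord_rot.
- by move=> h; rewrite chord_rot // -eE -fE; exact: only.
Qed.

End EvenCycles.

(** * Odd cycles and bridges *)

Section OddCycles.
Variables (K : fieldType) (n : nat) (G : sgraph n).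
Implicit Types (x y z v w : 'I_n) (c d p q s : seq 'I_n) (e f h : {set 'I_n}).
Hypothesis koszulG : Koszul (@rees_gen K n G).

Definition minimal_odd_cycle c := minimal_cycle G c /\ odd (size c).

Lemma minimal_odd_cycle_rot k c : minimal_odd_cycle c -> minimal_odd_cycle (rot k c).
Proof. by move=> [mc oc]; split; [exact: minimal_cycle_rot | rewrite size_rot]. Qed.

Lemma minimal_odd_cycle_at c x : minimal_odd_cycle c -> x \in c ->
  exists q, [/\ minimal_odd_cycle (x :: q), c =i x :: q &
    cycle_edges c = cycle_edges (x :: q)].
Proof.
move=> mc /rot_to[k q rc]; exists q; rewrite -rc; split.
- exact: minimal_odd_cycle_rot.
- by move=> v; rewrite mem_rot.
- by rewrite cycle_edges_rot // (is_cycle_uniq mc.1.1).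
Qed.

Lemma minimal_odd_cycle_cons x q : minimal_odd_cycle (x :: q) ->
  [/\ path (adj G) x (rcons q x), ~~ odd (size q), 1 < size q & uniq (x :: q)].
Proof. by move=> [[/and3P[sz pq uq] _] oq]. Qed.

Lemma minimal_odd_cycle_edge x q a b : minimal_odd_cycle (x :: q) ->
  adj G a b -> a \in x :: q -> b \in x :: q -> [set a; b] \in steps x (rcons q x).
Proof.
move=> mc ab ac bc; have [_ _ _ uq] := minimal_odd_cycle_cons mc.
rewrite -mem_cycle_edges //; apply: (minimal_cycle_edge mc.1 ab) => v.
by rewrite !inE => /orP[] /eqP ->; rewrite -in_cons.
Qed.

Lemma figure_eight_condition c1 c2 : minimal_odd_cycle c1 -> minimal_odd_cycle c2 ->
  #|[set x in c1] :&: [set x in c2]| = 1 ->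
  exists i j, [/\ i \in c1, j \in c2, [set i; j] \in edges G
    & [set i; j] \notin cycle_edges c1 :|: cycle_edges c2].
Proof.
move=> mc1 mc2 /eqP/cards1P[v c12]; apply: contrapT => noij.
have I u : (u \in c1) && (u \in c2) = (u == v).
  by have /setP/(_ u) := c12; rewrite !inE.
have /andP[v1 v2] : (v \in c1) && (v \in c2) by rewrite I.
have [q1 [m1 E1 ce1]] := minimal_odd_cycle_at mc1 v1.
have [q2 [m2 E2 ce2]] := minimal_odd_cycle_at mc2 v2.
have [p1 o1 sz1 u1] := minimal_odd_cycle_cons m1.
have [p2 o2 sz2 u2] := minimal_odd_cycle_cons m2.
have := u1; have := u2; rewrite !cons_uniq => /andP[vq2 uq2] /andP[vq1 uq1].
apply: (no_induced_figure_eight koszulG p1 o1 sz1 p2 o2 sz2).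
  rewrite cons_uniq mem_cat negb_or vq1 vq2 cat_uniq uq1 uq2 /= andbT.
  apply/hasPn => u uq2'; apply/negP => /= uq1'.
  have : u == v by rewrite -I E1 E2 !inE uq1' uq2' !orbT.
  by move/eqP => uv; rewrite -uv uq1' in vq1.
have mixed a b : a \in v :: q1 -> b \in v :: q2 -> adj G a b ->
    [set a; b] \in steps v (rcons q1 v) ++ steps v (rcons q2 v).
  rewrite -E1 -E2 => a1 b2 ab; rewrite mem_cat -!mem_cycle_edges // -ce1 -ce2.
  by apply: contrapT => /negP nab; apply: noij; exists a, b; rewrite inE nab.
move=> e eG eq; have [a [b [eE ab]]] := edge_pair eG.
have adjab : adj G a b by rewrite /adj -eE.
have in12 u : u \in e -> (u \in v :: q1) || (u \in v :: q2).
  by move/eq; rewrite !(inE, mem_cat); case: (u == v).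
have := in12 a; have := in12 b; rewrite eE !inE !eqxx orbT -!in_cons.
move=> /(_ isT)/orP[b1|b2] /(_ isT)/orP[a1|a2].
- by rewrite mem_cat (minimal_odd_cycle_edge m1 adjab a1 b1).
- by rewrite setUC; apply: mixed; rewrite // adjC.
- exact: mixed.
- by rewrite mem_cat (minimal_odd_cycle_edge m2 adjab a2 b2) orbT.
Qed.

(** Take the arc x q y shortest: then u has no neighbour inside it, and u closes
    it to a cycle without chords.  A neighbour of u in q splits the even list q
    into one even and one odd part, which allows the induction. *)
Lemma attach_arc u x q y s (c := x :: q ++ y :: s) : minimal_odd_cycle c ->
  ~~ odd (size q) -> u \notin c -> adj G u x -> adj G u y ->
  exists d, [/\ minimal_odd_cycle d, u \in d & {subset d <= u :: c}].
Proof.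
rewrite /c {c}; have [m] := ubnP (size q).
elim: m => // m IHm in x q y s * => szq mc evq uc ux uy.
(* A neighbour z inside the arc leaves a shorter even arc, before or after z. *)
have [/hasP[z zq uz]|/hasPn noz] := boolP (has (adj G u) q).
  case/splitPr: zq => q1 q2 in szq mc evq uc *.
  rewrite size_cat /= ltnS in szq; rewrite size_cat /= addnS /= negbK oddD in evq.
  case o1 : (odd (size q1)) in evq *.
    pose c' := z :: q2 ++ y :: (s ++ x :: q1).
    have c'E : c' = rot (size q1).+1 (x :: (q1 ++ z :: q2) ++ y :: s).
      by rewrite -catA -cat_cons (rot_size_cat (x :: q1)) /c' /= -catA.
    have [|||||//|d [md ud dc]] := IHm z q2 y (s ++ x :: q1).
    - by move: szq; clear; lia.
    - by rewrite -/c' c'E; exact: minimal_odd_cycle_rot.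
    - by move: evq; case: odd.
    - by rewrite -/c' c'E mem_rot.
    - by [].
    exists d; split=> // v /dc; rewrite in_cons => /predU1P[->|].
      exact: mem_head.
    by rewrite -/c' c'E mem_rot [v \in u :: _]in_cons => ->; rewrite orbT.
  have [|||//|//|//|d [md ud dc]] := IHm x q1 z (q2 ++ y :: s).
  - by move: szq; clear; lia.
  - by move: mc; rewrite -catA.
  - by rewrite o1.
  - by move: uc; rewrite -catA.
  by exists d; split=> // v /dc; rewrite -catA.
have [pc oc szc uniq_c] := minimal_odd_cycle_cons mc.
pose d := u :: x :: rcons q y.
have os : odd (size s).
  by move: oc; rewrite size_cat /= addnS /= negbK oddD (negPf evq) addFb.
have pE : rcons (q ++ y :: s) x = rcons q y ++ rcons s x.
  by rewrite rcons_cat cat_rcons.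
have cW e : e \in cycle_edges (x :: q ++ y :: s) ->
    e \in steps x (rcons q y) ++ steps y (rcons s x).
  by rewrite mem_cycle_edges // pE steps_cat last_rcons.
have pxy : path (adj G) x (rcons q y) by move: pc; rewrite pE cat_path => /andP[].
have subc : {subset x :: rcons q y <= x :: q ++ y :: s}.
  by move=> v; rewrite -cat_rcons -cat_cons mem_cat => ->.
have ud : uniq d.
  rewrite cons_uniq (contra (subc u) uc) /=.
  by move: uniq_c; rewrite -cat_rcons -cat_cons cat_uniq => /andP[].
have cycd : is_cycle G d.
  by rewrite is_cycle_cons ud andbT /= size_rcons /= ux rcons_path pxy last_rcons adjC.
have SD : steps u (rcons (x :: rcons q y) u)
    = [set u; x] :: rcons (steps x (rcons q y)) [set y; u].
  by rewrite /= steps_rcons last_rcons.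
exists d; split; last 2 first.
- exact: mem_head.
- by move=> v; rewrite !in_cons => /predU1P[->|/subc]; rewrite ?eqxx // !inE => ->; rewrite orbT.
split; last by rewrite /= size_rcons /= negbK (negPf evq).
split=> // e; apply/negP => ch; have hd := chord_mem ch.
have /and3P[eG _] := ch; rewrite mem_cycle_edges // SD inE mem_rcons inE.
rewrite !negb_or => /and3P[e1 e2 e3].
have [ue|ue] := boolP (u \in e).
  have [z [eE uz]] : exists z, e = [set u; z] /\ u != z.
    have [a [b [eE ab]]] := edge_pair eG; move: ue; rewrite eE !inE.
    case/orP=> /eqP uE; first by exists b; rewrite uE.
    by exists a; rewrite uE setUC eq_sym.
  have uz' : adj G u z by rewrite /adj -eE.
  have : z \in d by apply: hd; rewrite eE !inE eqxx orbT.
  rewrite !inE mem_rcons inE eq_sym (negPf uz) /= => /or3P[/eqP zE|/eqP zE|zq].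
  - by rewrite eE zE eqxx in e1.
  - by rewrite eE zE setUC eqxx in e2.
  - by have := noz z zq; rewrite uz'.
have ec : {subset e <= x :: q ++ y :: s}.
  move=> v ve; apply: subc; have := hd v ve; rewrite inE => /predU1P[vu|//].
  by rewrite -vu ve in ue.
have := cW e (minimal_cycle_edge mc.1 eG ec); rewrite mem_cat (negPf e3) /=.
case/(steps_interior (h := e)); first by case: (s) os.
move=> v vs ve; have := hd v ve; rewrite inE => /predU1P[vu|].
  by rewrite -vu ve in ue.
move=> vp; move: uniq_c; rewrite -cat_rcons -cat_cons cat_uniq.
by case/and3P=> _ /hasPn/(_ v vs) /=; rewrite vp.
Qed.

(** One of the two arcs of an odd cycle between x and y has an even number of
    inner vertices. *)
Lemma attach u c x y : minimal_odd_cycle c -> u \notin c -> x \in c -> y \in c ->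
  x != y -> adj G u x -> adj G u y ->
  exists d, [/\ minimal_odd_cycle d, u \in d & {subset d <= u :: c}].
Proof.
move=> mc uc xc yc xy ux uy; have uniq_c := is_cycle_uniq mc.1.1.
have sub k d : {subset d <= u :: rot k c} -> {subset d <= u :: c}.
  by move=> dc v /dc; rewrite !in_cons mem_rot.
have [k [p1 [p2 [rc _ _]]]] := split_cycle uniq_c xc yc xy.
have := minimal_odd_cycle_rot k mc; rewrite rc => mrc.
have urc : u \notin x :: p1 ++ y :: p2 by rewrite -rc mem_rot.
have [o1|ev1] := boolP (odd (size p1)); last first.
  have [d [md ud dc]] := attach_arc mrc ev1 urc ux uy.
  by exists d; split=> //; apply: (sub k); rewrite rc.
have ev2 : ~~ odd (size p2).
  by have := mrc.2; rewrite /= size_cat /= addnS /= negbK oddD o1; case: odd.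
have r2 : rot (size p1).+1 (rot k c) = y :: p2 ++ x :: p1.
  by rewrite rc -cat_cons (rot_size_cat (x :: p1)).
have := minimal_odd_cycle_rot (size p1).+1 (minimal_odd_cycle_rot k mc).
rewrite r2 => mr2.
have ur2 : u \notin y :: p2 ++ x :: p1 by rewrite -r2 !mem_rot.
have [d [md ud dc]] := attach_arc mr2 ev2 ur2 uy ux.
exists d; split=> //; apply: (sub k) => v /dc.
by rewrite in_cons -r2 mem_rot -in_cons.
Qed.

Lemma bridgesC c1 c2 : bridges G c1 c2 = bridges G c2 c1.
Proof.
apply/setP => e; rewrite !inE; congr (_ && _).
by apply/existsP/existsP => -[i /existsP[j /and3P[ic jc /eqP eE]]]; exists j;
  apply/existsP; exists i; rewrite ic jc eE setUC eqxx.
Qed.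

Lemma mem_bridges c1 c2 a b : a \in c1 -> b \in c2 -> adj G a b ->
  [set a; b] \in bridges G c1 c2.
Proof.
move=> ac bc ab; rewrite inE; apply/andP; split; first exact: ab.
by apply/existsP; exists a; apply/existsP; exists b; rewrite ac bc eqxx.
Qed.

Lemma bridgesP c1 c2 e : e \in bridges G c1 c2 ->
  exists a b, [/\ a \in c1, b \in c2, e = [set a; b] & adj G a b].
Proof.
rewrite inE => /andP[eG /existsP[a /existsP[b /and3P[ac bc /eqP eE]]]].
by exists a, b; split=> //; rewrite /adj -eE.
Qed.

(** The neighbours x and y of u give a minimal odd cycle d1 through u.  All its
    bridges to c2 start at u, so if there are two, there is also such a cycle d2
    in c2 and u.  An edge between d1 and d2 beside theirs would join c1 and c2,
    so d1 and d2 violate the condition on cycles with one common vertex. *)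
Lemma double_attachment c1 c2 u x y :
  minimal_odd_cycle c1 -> minimal_odd_cycle c2 ->
  {in c1, forall v, v \notin c2} -> u \notin c1 -> u \notin c2 ->
  {in c1, forall v, {in c2, forall w, ~~ adj G v w}} ->
  x \in c1 -> y \in c1 -> x != y -> adj G u x -> adj G u y ->
  ~ (forall d, minimal_odd_cycle d -> {in d, forall v, v \notin c2} -> u \in d ->
       2 <= #|bridges G d c2|).
Proof.
move=> mc1 mc2 dis uc1 uc2 noadj xc yc xy ux uy H.
have [d1 [md1 ud1 dc1]] := attach mc1 uc1 xc yc xy ux uy.
have dis1 : {in d1, forall v, v \notin c2}.
  by move=> v /dc1; rewrite inE => /predU1P[->//|/dis].
have /card_gt1P[e1 [e2 [e1b e2b e12]]] := H d1 md1 dis1 ud1.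
have bE e : e \in bridges G d1 c2 -> exists2 w, w \in c2 /\ adj G u w & e = [set u; w].
  move=> /bridgesP[a [w [ad wc -> aw]]]; exists w => //.
    move: (dc1 a ad); rewrite inE => /predU1P[<-//|ac].
    by case/negP: (noadj a ac w wc).
  move: (dc1 a ad); rewrite inE => /predU1P[<-//|ac].
  by case/negP: (noadj a ac w wc).
have [w1 [w1c uw1] e1E] := bE e1 e1b; have [w2 [w2c uw2] e2E] := bE e2 e2b.
have w12 : w1 != w2 by apply: contraNneq e12 => ww; rewrite e1E e2E ww.
have [d2 [md2 ud2 dc2]] := attach mc2 uc2 w1c w2c w12 uw1 uw2.
have d12 : [set v in d1] :&: [set v in d2] = [set u].
  apply/setP => v; rewrite !inE; apply/andP/eqP => [[v1 v2]|->//].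
  move: (dc2 v v2); rewrite inE => /predU1P[//|vc2].
  by have := dis1 v v1; rewrite vc2.
have [|i [j [id1 jd2 ijG]]] := figure_eight_condition md1 md2.
  by rewrite d12 cards1.
rewrite inE negb_or => /andP[/negP ni /negP nj].
have := dc1 i id1; rewrite inE => /predU1P[iu|ic].
  apply: nj; apply: (minimal_cycle_edge md2.1 ijG) => v.
  by rewrite !inE iu => /orP[] /eqP ->.
have := dc2 j jd2; rewrite inE => /predU1P[ju|jc].
  apply: ni; apply: (minimal_cycle_edge md1.1 ijG) => v.
  by rewrite !inE ju => /orP[] /eqP ->.
by case/negP: (noadj i ic j jc).
Qed.

Lemma steps_mid x p1 a b p2 : [set a; b] \in steps x (p1 ++ a :: b :: p2).
Proof. by rewrite steps_cat mem_cat /= !inE eqxx !orbT. Qed.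

(** By induction on the length of a path from c1 to c2, which may be taken
    shortest.  If its second vertex has two neighbours on c1, or its last but
    one two on c2, double_attachment applies with the induction hypothesis.
    Otherwise c1, c2 and the path induce a dumbbell, where a path of length 1
    is the only bridge. *)
Lemma two_bridges_path c1 c2 x q :
  minimal_odd_cycle c1 -> minimal_odd_cycle c2 ->
  {in c1, forall v, v \notin c2} ->
  x \in c1 -> path (adj G) x q -> last x q \in c2 ->
  2 <= #|bridges G c1 c2|.
Proof.
have [m] := ubnP (size q); elim: m => // m IHm in c1 c2 x q *.
move=> szq mc1 mc2 dis xc1 pxq0; case/shortenP: pxq0 => s pxs uxs sub_sq ls.
have {}szq : size s < m.+1.
  apply: leq_ltn_trans szq; apply: uniq_leq_size => //.
  by move: uxs; rewrite cons_uniq => /andP[].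
move: s pxs uxs ls szq {sub_sq q} => q pxq uxq lc2 szq; apply: contraT; rewrite -ltnNge ltnS => br1.
have shortest y s : y \in c1 -> path (adj G) y s -> last y s \in c2 ->
    size q <= size s.
  move=> yc pys ls; rewrite leqNgt; apply/negP => lt_sq.
  suff : 2 <= #|bridges G c1 c2| by rewrite ltnNge br1.
  by apply: (IHm c1 c2 y s) => //; apply: leq_trans lt_sq _; rewrite -ltnS.
case: (lastP q) => [|Q w] in szq pxq lc2 shortest uxq *.
  by have := dis x xc1; rewrite lc2.
rewrite last_rcons in lc2; rewrite size_rcons in szq shortest.
(* An edge that skips a vertex of the path would give a shorter path. *)
have c1Q a Q1 b Q2 : Q = Q1 ++ b :: Q2 -> a \in c1 -> adj G a b -> Q1 = [::].
  move=> QE ac ab; have := shortest a (b :: rcons Q2 w) ac.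
  move: pxq; rewrite QE rcons_cat cat_path /= => /and3P[_ _ ->].
  rewrite ab last_rcons lc2 size_cat /= size_rcons => /(_ isT isT).
  by case: Q1 {QE} => //= a1 Q1; clear; lia.
have Qc2 a Q1 b Q2 : Q = Q1 ++ a :: Q2 -> b \in c2 -> adj G a b -> Q2 = [::].
  move=> QE bc ab; have := shortest x (rcons (rcons Q1 a) b) xc1.
  move: pxq; rewrite QE rcons_cat /= -cat_rcons cat_path => /andP[pa _].
  rewrite rcons_path pa !last_rcons ab bc size_cat /= !size_rcons => /(_ isT isT).
  by case: Q2 {QE} => //= a1 Q2; clear; lia.
have QQ a b Q1 Q2 Q3 : Q = Q1 ++ a :: Q2 ++ b :: Q3 -> adj G a b -> Q2 = [::].
  move=> QE ab; have := shortest x (rcons (Q1 ++ a :: b :: Q3) w) xc1.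
  move: pxq; rewrite QE !rcons_cat /= rcons_cat /= !cat_path /= cat_path /=.
  case/and5P=> -> -> _ _ ->; rewrite ab last_cat /= last_rcons lc2.
  rewrite !size_cat /= size_cat /= size_rcons => /(_ isT isT).
  by case: Q2 {QE} => //= a1 Q2; clear; lia.
have Qnc1 b : b \in Q -> b \notin c1.
  move=> bQ; apply/negP => bc; case/splitPr: bQ pxq shortest => Q1 Q2.
  rewrite rcons_cat cat_path /= => /and3P[_ _ pb] /(_ b (rcons Q2 w) bc pb).
  by rewrite last_rcons lc2 size_cat size_rcons /= => /(_ isT); clear; lia.
have Qnc2 b : b \in Q -> b \notin c2.
  move=> bQ; apply/negP => bc; case/splitPr: bQ pxq shortest => Q1 Q2.
  rewrite rcons_cat /= -cat_rcons cat_path => /andP[pb _] /(_ x (rcons Q1 b) xc1 pb).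
  by rewrite last_rcons bc size_cat size_rcons /= => /(_ isT); clear; lia.
have c12 a b : a \in c1 -> b \in c2 -> adj G a b -> Q = [::] /\ [set a; b] = [set x; w].
  move=> ac bc ab; have := shortest a [:: b] ac; rewrite /= ab bc => /(_ isT isT).
  case: Q pxq br1 {szq shortest uxq c1Q Qc2 QQ Qnc1 Qnc2} => //= /andP[xw _] br1 _.
  split=> //; have b1 := mem_bridges ac bc ab; have b2 := mem_bridges xc1 lc2 xw.
  by apply/(card_le1_eqP br1).
have noadj : Q != [::] -> {in c1, forall v, {in c2, forall w, ~~ adj G v w}}.
  by move=> Q0 v vc u uc; apply/negP => /(c12 v u vc uc)[QE _]; rewrite QE in Q0.
have first_adj b Q' a : Q = b :: Q' -> a \in c1 -> adj G a b -> a = x.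
  move=> QE ac ab; apply/eqP; apply: contraT => ax; exfalso.
  have [xb pb] : adj G x b /\ path (adj G) b (rcons Q' w).
    by move: pxq; rewrite QE /= => /andP[].
  have bQ : b \in Q by rewrite QE mem_head.
  apply: (double_attachment (u := b) mc1 mc2 dis (Qnc1 b bQ) (Qnc2 b bQ)
    _ ac xc1 ax).
  - by apply: noadj; rewrite QE.
  - by rewrite adjC.
  - by rewrite adjC.
  move=> d md disd bd; apply: (IHm d c2 b (rcons Q' w)) => //.
    by move: szq; rewrite QE size_rcons ltnS.
  by rewrite last_rcons.
have last_adj Q' a b : Q = rcons Q' a -> b \in c2 -> adj G a b -> b = w.
  move=> QE bc ab; apply/eqP; apply: contraT => bw; exfalso.
  have [pQ aw] : path (adj G) x Q /\ adj G a w.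
    by move: pxq; rewrite rcons_path QE last_rcons => /andP[].
  have aQ : a \in Q by rewrite QE mem_rcons mem_head.
  apply: (double_attachment (u := a) mc2 mc1 _ (Qnc2 a aQ) (Qnc1 a aQ)
    _ bc lc2 bw) => //.
  - by move=> v vc2; apply/negP => /dis; rewrite vc2.
  - move=> v vc2 u uc1; rewrite adjC; apply: noadj => //.
    by rewrite QE; case: (Q').
  move=> d md disd ad; rewrite bridgesC; apply: (IHm c1 d x Q) => //.
    by move=> v vc1; apply/negP => /disd; rewrite vc1.
  by rewrite QE last_rcons.
have [q1 [m1 E1 _]] := minimal_odd_cycle_at mc1 xc1.
have [q2 [m2 E2 _]] := minimal_odd_cycle_at mc2 lc2.
have [p1 o1 sz1 u1] := minimal_odd_cycle_cons m1.
have [p2 o2 sz2 u2] := minimal_odd_cycle_cons m2.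
have := u1; have := u2; rewrite !cons_uniq => /andP[wq2 uq2] /andP[xq1 uq1].
have q1c u : u \in q1 -> u \in c1 by rewrite E1 inE => ->; rewrite orbT.
have q2c u : u \in q2 -> u \in c2 by rewrite E2 inE => ->; rewrite orbT.
exfalso; apply: (no_induced_dumbbell koszulG p1 o1 sz1 pxq p2 o2 sz2).
  have -> : x :: Q ++ w :: q2 = (x :: rcons Q w) ++ q2 by rewrite /= cat_rcons.
  rewrite cat_uniq uq1 cat_uniq uxq uq2 andbT andTb.
  apply/andP; split; apply/hasPn => u.
    rewrite mem_cat in_cons mem_rcons inE => /orP[/or3P[/eqP->//|/eqP->|uQ]|u2'].
    - by apply/negP => /q1c/dis; rewrite lc2.
    - by apply/negP => /q1c uc; case/negP: (Qnc1 u uQ).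
    - by apply/negP => /q1c/dis; rewrite (q2c u u2').
  move=> u2'; rewrite /= inE mem_rcons inE; apply/negP => /or3P[/eqP uE|/eqP uE|uQ].
  - by have := dis x xc1; rewrite -uE (q2c u u2').
  - by rewrite -uE u2' in wq2.
  - by have := Qnc2 u uQ; rewrite (q2c u u2').
pose W := steps x (rcons q1 x) ++ steps x (rcons Q w) ++ steps w (rcons q2 w).
have T11 a b : a \in c1 -> b \in c1 -> adj G a b -> [set a; b] \in W.
  by rewrite !E1 => ac bc ab; rewrite mem_cat (minimal_odd_cycle_edge m1).
have T22 a b : a \in c2 -> b \in c2 -> adj G a b -> [set a; b] \in W.
  by rewrite !E2 => ac bc ab; rewrite !mem_cat (minimal_odd_cycle_edge m2) ?orbT.
have TQ h : h \in steps x (rcons Q w) -> h \in W.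
  by move=> hs; rewrite !mem_cat hs orbT.
have T12 a b : a \in c1 -> b \in c2 -> adj G a b -> [set a; b] \in W.
  by move=> ac bc /(c12 a b ac bc)[QE ->]; apply: TQ; rewrite QE mem_head.
have T1Q a b : a \in c1 -> b \in Q -> adj G a b -> [set a; b] \in W.
  move=> ac bQ ab; apply: TQ; move: (first_adj b) (c1Q a).
  case/splitPr: bQ => Q1 Q2 fst /(_ Q1 b Q2 erefl ac ab) Q1E.
  by rewrite Q1E in fst *; rewrite (fst Q2 a erefl ac ab) /= mem_head.
have TQ2 a b : a \in Q -> b \in c2 -> adj G a b -> [set a; b] \in W.
  move=> aQ bc ab; apply: TQ; move: last_adj (Qc2 a).
  case/splitPr: aQ => Q1 Q2 lst /(_ Q1 b Q2 erefl bc ab) Q2E.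
  rewrite Q2E in lst *; rewrite (lst Q1 a b _ bc ab) ?cats1 //.
  by rewrite -[X in steps x X]cats1 -cats1 -catA; exact: steps_mid.
have TQQ a b : a \in Q -> b \in Q -> adj G a b -> [set a; b] \in W.
  move=> aQ bQ ab; apply: TQ; move: bQ (QQ a b) (QQ b a).
  case/splitPr: aQ => Q1 Q2; rewrite mem_cat in_cons => /or3P[bQ|/eqP bE|bQ].
  - case/splitPr: bQ => Q3 Q4 _ /(_ Q3 Q4 Q2).
    rewrite -catA /= => /(_ erefl); rewrite adjC => /(_ ab) ->.
    by rewrite setUC rcons_cat /=; exact: steps_mid.
  - by have := adj_neq ab; rewrite bE eqxx.
  case/splitPr: bQ => Q3 Q4 /(_ Q1 Q3 Q4 erefl ab) -> _.
  by rewrite rcons_cat /=; exact: steps_mid.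
move=> e eG eV; have [a [b [eE ab]]] := edge_pair eG.
have adjab : adj G a b by rewrite /adj -eE.
have loc u : u \in e -> [\/ u \in c1, u \in Q | u \in c2].
  move/eV; rewrite E1 E2 !(mem_cat, in_cons).
  case/or3P=> [->|->|/or3P[->|->|->]]; rewrite ?orbT;
    by [constructor 1 | constructor 2 | constructor 3].
rewrite -/W eE; have := loc a; have := loc b; rewrite eE !inE !eqxx orbT.
have adjba : adj G b a by rewrite adjC.
case/(_ isT) => [b1|bQ|b2] /(_ isT) [a1|aQ|a2];
  by [exact: T11 | exact: T12 | exact: T1Q | exact: TQQ | exact: TQ2 | exact: T22
     | rewrite setUC; exact: T12 | rewrite setUC; exact: T1Q
     | rewrite setUC; exact: TQ2].
Qed.

Lemma bridges_condition c1 c2 : minimal_odd_cycle c1 -> minimal_odd_cycle c2 ->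
  [set x in c1] :&: [set x in c2] = set0 -> 2 <= #|bridges G c1 c2|.
Proof.
move=> mc1 mc2 c12; have dis : {in c1, forall v, v \notin c2}.
  move=> v v1; apply/negP => v2.
  by have /setP/(_ v) := c12; rewrite !inE v1 v2.
have edge_at c : minimal_odd_cycle c ->
    exists x y, [/\ x \in c, [set x; y] \in edges G & x \in [set x; y]].
  case=> -[cyc _] _; case: c cyc => // x [//|y q] /and3P[_ /andP[xy _] _].
  by exists x, y; rewrite mem_head !inE eqxx; split=> //; case/andP: xy.
have [x [x' [xc xG xx]]] := edge_at c1 mc1; have [y [y' [yc yG yy]]] := edge_at c2 mc2.
have /connectP[q pq yE] := koszul_connected koszulG xG yG xx yy.
by apply: (two_bridges_path mc1 mc2 dis xc pq); rewrite -yE.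
Qed.

(** A component with two vertices contains an edge, so koszul_connected puts all
    such components together. *)
Lemma num_components1 : edges G != set0 -> num_components G = 1.
Proof.
case/set0Pn=> e eG; have [x [y [eE xy]]] := edge_pair eG.
have csym := sym_connect_sym (@adjC n G).
have xe : x \in e by rewrite eE !inE eqxx.
apply/eqP/cards1P; exists [set z | connect (adj G) x z].
apply/setP => B; rewrite !inE; apply/andP/eqP => [[/imsetP[z _ ->]]|->].
  set B' := [set _ in _ | _] => /card_gt1P[a [b [aB bB ab]]].
  have [z' zz'] : exists z', adj G z z'.
    have nb u : connect (adj G) z u -> z != u -> exists z', adj G z z'.
      case/connectP=> -[|z' q] /= => [_ -> |/andP[zz' _] _ _]; last by exists z'.
      by rewrite eqxx.
    move: aB bB; rewrite !inE /= => za zb; have [az|/nb] := eqVneq z a.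
      by apply: (nb b zb); rewrite az.
    exact.
  have xz : connect (adj G) x z.
    by apply: (koszul_connected koszulG eG (zz' : [set z; z'] \in _)) => //;
      rewrite !inE eqxx.
  by apply/setP => u; rewrite !inE /= (same_connect csym xz).
split.
  apply/imsetP; exists x; rewrite ?inE //.
  by apply/setP => u; rewrite !inE.
apply/card_gt1P; exists x, y; split=> //; rewrite inE ?connect0 //.
by apply: connect1; rewrite /adj -eE.
Qed.

End OddCycles.

Theorem theorem2p1 (K : fieldType) (n : nat) (G : sgraph n) :
  edges G != set0 ->
  Koszul (@rees_gen K n G) ->
  [/\ num_components G = 1%N,
      (forall c : seq 'I_n,
         is_cycle G c -> ~~ odd (size c) -> (6 <= size c)%N ->
         (exists e, even_chord G c e) \/
         (exists e e' e'',
            [/\ odd_chord G c e, odd_chord G c e' & odd_chord G c e''] /\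
            [/\ e != e', e != e'', e' != e'' & cross c e e'])),
      (forall c1 c2 : seq 'I_n,
         minimal_cycle G c1 -> odd (size c1) ->
         minimal_cycle G c2 -> odd (size c2) ->
         #|[set x in c1] :&: [set x in c2]| = 1%N ->
         exists i j,
           [/\ i \in c1, j \in c2, [set i; j] \in edges G
             & [set i; j] \notin cycle_edges c1 :|: cycle_edges c2])
    & (forall c1 c2 : seq 'I_n,
         minimal_cycle G c1 -> odd (size c1) ->
         minimal_cycle G c2 -> odd (size c2) ->
         [set x in c1] :&: [set x in c2] = set0 ->
         (2 <= #|bridges G c1 c2|)%N)].
Proof.
move=> G0 koszulG; split.
- exact: num_components1 koszulG G0.
- exact: even_cycle_condition koszulG.
- move=> c1 c2 m1 o1 m2 o2.
  exact: (figure_eight_condition koszulG (conj m1 o1) (conj m2 o2)).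
- move=> c1 c2 m1 o1 m2 o2.
  exact: (bridges_condition koszulG (conj m1 o1) (conj m2 o2)).
Qed.
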